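(* Let $n\ge 2$, let $A\in\mathbb{Z}^{m\times n}$ have full column rank, and let $b\in\mathbb{Z}^m$ and $c\in\mathbb{Q}^n$. Let $x^*$ be an optimal vertex of the linear program $\max\{c^\top x : x\in\mathbb{R}^n,\ Ax\le b\}$. If the integer program $\max\{c^\top x : x\in\mathbb{Z}^n,\ Ax\le b\}$ is feasible, then it has an optimal solution $z^*$ such that $$\|x^*-z^*\|_\infty<\frac{n}{2}\cdot\Delta_{n-1}(A).$$
   Context: For a matrix $A$ and a positive integer $k$, $\Delta_k(A):=\max\{|\det M| : M \text{ is a } k\times k \text{ submatrix of } A\}$. An optimal vertex of the linear program is a vertex of the polyhedron $\{x\in\mathbb{R}^n: Ax\le b\}$ that attains the maximum of $c^\top x$ over it. *)

(* Defs.v *)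
From mathcomp Require Import all_boot all_order all_algebra.
From mathcomp Require Import classical_sets reals topology normedtype.

Set Implicit Arguments.
Unset Strict Implicit.
Unset Printing Implicit Defensive.

Import Order.TTheory GRing.Theory Num.Theory numFieldNormedType.Exports.

Local Open Scope classical_set_scope.
Local Open Scope ring_scope.

Definition increasing (k p : nat) (f : {ffun 'I_k -> 'I_p}) : bool :=
  [forall i : 'I_k, forall j : 'I_k, (i < j)%N ==> (f i < f j)%N].

(* A k x k submatrix is given by increasing selections of k rows and k columns.
   The value is 0 when there are none, i.e. when k > minn m n. *)
Definition Delta (m n k : nat) (A : 'M[int]_(m, n)) : nat :=
  \max_(f : {ffun 'I_k -> 'I_m} | increasing f)
    \max_(g : {ffun 'I_k -> 'I_n} | increasing g) `|\det (mxsub f g A)|%N.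

Definition polyhedron (R : realType) (m n : nat)
    (A : 'M[int]_(m, n)) (b : 'cV[int]_m) : set 'cV[R]_n :=
  [set x | forall i : 'I_m, (map_mx intr A *m x) i 0 <= (b i 0)%:~R].
Arguments polyhedron R {m n} A b _ : rename.

Definition integer_points (R : realType) (n : nat) : set 'cV[R]_n :=
  range (fun z : 'cV[int]_n => map_mx intr z).
Arguments integer_points R n _ : clear implicits, rename.

(* A vertex is a point of P that is not a proper convex combination of two
   other points of P. *)
Definition vertex (R : realType) (n : nat) (P : set 'cV[R]_n) (x : 'cV[R]_n) :
    Prop :=
  P x /\ forall (y z : 'cV[R]_n) (t : R), P y -> P z -> 0 < t < 1 ->
    x = t *: y + (1 - t) *: z -> y = x /\ z = x.

Definition optimal (R : realType) (n : nat) (c : 'cV[rat]_n) (S : set 'cV[R]_n)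
    (x : 'cV[R]_n) : Prop :=
  S x /\ forall y : 'cV[R]_n, S y ->
    ((map_mx ratr c)^T *m y) 0 0 <= ((map_mx ratr c)^T *m x) 0 0.

(* Main.v *)
(* Write a_i for the rows of A and Delta for Delta_(n-1)(A).  Among the integer
   optima take the one, z, that also maximises the sum of the constraints tight
   at x*, and let w = z - x*.  Call q a part of w if every a_i q lies between 0
   and a_i w.  If u is integral, q is a part of w, 0 <= tau <= 1 and
   |a_i u - tau a_i q| < 1 for all i, then u = 0: by integrality z - u is
   feasible and a_i u <= 0 for the rows tight at x*, so x* + eps u is feasible,
   z - u is again optimal, and the choice of z makes all tight rows vanish on u,
   which is impossible for u <> 0 since x* is a vertex.

   Let q be a part of w, d the dimension of the common kernel of the rows
   vanishing on q, and al = +-e_k.  A pigeonhole argument modulo the lattice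
   spanned by al and n-1 suitably chosen rows produces such a u unless
   al q < Delta (if d <= 2) or al q < 3/2 Delta (if d <= 3).  Since w splits into
   parts, each but the last with d <= 2 and lowering the dimension of the rest by
   2, and the last with d <= 2 or d = 3, summing up gives al w < n/2 Delta. *)
Require Import Defs.
From mathcomp Require Import boolp classical_sets reals topology normedtype.
From mathcomp Require Import all_boot all_order all_algebra perm.
From mathcomp Require Import zify ring lra.

Set Implicit Arguments.
Unset Strict Implicit.
Unset Printing Implicit Defensive.

Import Order.TTheory GRing.Theory Num.Theory numFieldNormedType.Exports.

Local Open Scope ring_scope.

(** * Determinants and lattices *)

Lemma absz_det_unitmx n (L : 'M[int]_n) : L \in unitmx -> `|\det L|%N = 1%N.
Proof. by rewrite unitmxE => /orP[] /eqP ->. Qed.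

(** Write the Smith form as [B = L D T]. The class of [x] collects the residues of [x T^-1] modulo
    the diagonal entries of [D], whose product is [det B] up to sign. *)
Lemma lattice_classes n (B : 'M[int]_n) : \det B != 0 ->
  exists (F : finType) (cls : 'rV[int]_n -> F), #|F| = `|\det B|%N /\
    forall x y, cls x = cls y -> exists u : 'rV[int]_n, x - y = u *m B.
Proof.
move=> detB; have [L uL [T uT [d _ defB]]] := int_Smith_normal_form B.
set D := (\matrix_(i, j) _) in defB.
pose e (j : 'I_n) : int := nth 0 d j.
have DE : D = diag_mx (\row_j e j).
  apply/matrixP=> i j; rewrite !mxE val_eqE.
  by case: eqVneq => [->|].
have absB : `|\det B|%N = (\prod_(j < n) `|e j|)%N.
  rewrite defB !det_mulmx !abszM.
  rewrite (absz_det_unitmx uL) (absz_det_unitmx uT) mul1n muln1 DE det_diag.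
  rewrite (big_morph absz abszM (erefl : `|1%R|%N = 1%N)).
  by apply: eq_bigr => j _; rewrite mxE.
have d_neq0 (j : 'I_n) : e j != 0.
  apply: contraNneq detB => dj0; rewrite -absz_eq0 absB.
  by rewrite (bigD1 j) //= dj0 mul0n.
have modlt (j : 'I_n) (x : int) : (`|(x %% e j)%Z| < `|e j|)%N.
  by have := ltz_mod x (d_neq0 j); have := modz_ge0 x (d_neq0 j); lia.
pose F := {dffun forall j : 'I_n, 'I_(`|e j|)}.
pose cls (x : 'rV[int]_n) : F := [ffun j => Ordinal (modlt j ((x *m invmx T) 0 j))].
exists F, cls; split.
  rewrite card_dep_ffun absB /image_mem foldrE big_map big_enum /=.
  by apply: eq_bigr => j _; rewrite card_ord.
move=> x y eqxy; pose z := (x - y) *m invmx T.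
have zE j : z ord0 j = (z ord0 j %/ e j)%Z * e j.
  apply/esym/eqP; rewrite -dvdz_eq /z mulmxBl.
  have /ffunP/(_ j) := eqxy; rewrite !ffunE => /(congr1 val) /=.
  move: (x *m _) (y *m _) => X Y; rewrite 2!mxE -eqz_mod_dvd => eqXY.
  have := modz_ge0 (X 0 j) (d_neq0 j); have := modz_ge0 (Y 0 j) (d_neq0 j).
  by move=> ? ?; apply/eqP; lia.
exists ((\row_j (z ord0 j %/ e j)%Z) *m invmx L).
rewrite defB !mulmxA mulmxKV // DE.
have -> : \row_j (z ord0 j %/ e j)%Z *m diag_mx (\row_j e j) = z.
  by move: (z) zE => y' zE'; apply/rowP=> j; rewrite mul_mx_diag !mxE -zE'.
by rewrite mulmxKV.
Qed.

Lemma enum_val_increasing m (S : {set 'I_m}) (i j : 'I_#|S|) :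
  (i < j)%N -> (enum_val i < enum_val j)%N.
Proof.
move=> ltij; pose s := map val (enum S).
have sorted_s : sorted ltn s.
  have : subseq s (map val (enum 'I_m)).
    by apply: map_subseq; rewrite [enum 'I_m]enumT; apply: filter_subseq.
  by move/subseq_sorted; apply; [exact: ltn_trans | rewrite val_enum_ord iota_ltn_sorted].
have szs : size s = #|S| by rewrite size_map -cardE.
have x0 : 'I_m := enum_val i.
rewrite !(enum_val_nth x0) -!(nth_map x0 0%N val) -?cardE //.
by have := @sorted_ltn_nth nat ltn ltn_trans 0%N s sorted_s i j; rewrite !inE szs; apply.
Qed.

(** A repeated row makes the determinant vanish. Otherwise sorting the chosen rows changes only its
    sign and yields a selection that [Delta] ranges over. *)
Lemma det_mxsub_le_Delta (m n k : nat) (A : 'M[int]_(m, n))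
    (f : 'I_k -> 'I_m) (g : {ffun 'I_k -> 'I_n}) :
  increasing g -> (`|\det (mxsub f g A)| <= Delta k A)%N.
Proof.
move=> incg; case: (boolP (injectiveb f)) => [/injectiveP injf|]; last first.
  case/injectivePn => i [j neij eqf].
  rewrite (determinant_alternate neij) // => l; by rewrite !mxE eqf.
pose S := [set f i | i in 'I_k].
have cardS : #|S| = k by rewrite card_imset // card_ord.
pose h : {ffun 'I_k -> 'I_m} := [ffun i => enum_val (cast_ord (esym cardS) i)].
have inch : increasing h.
  apply/forallP=> i; apply/forallP=> j; apply/implyP=> ltij.
  by rewrite !ffunE; apply: enum_val_increasing.
have hf i : exists j, f j == h i.
  have : h i \in S by rewrite ffunE enum_valP.
  by case/imsetP => j _ ->; exists j.
pose s i := xchoose (hf i).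
have fs i : f (s i) = h i by apply/eqP/(xchooseP (hf i)).
have injs : injective s.
  move=> i j /(congr1 f); rewrite !fs !ffunE => /enum_val_inj /(congr1 val) /= ?.
  exact: val_inj.
have -> : `|\det (mxsub f g A)|%N = `|\det (mxsub h g A)|%N.
  have -> : mxsub h g A = row_perm (perm injs) (mxsub f g A).
    by apply/matrixP=> i j; rewrite !mxE permE fs.
  by rewrite row_permE det_mulmx det_perm abszMsign.
by apply: leq_trans (leq_bigmax_cond h inch); apply: leq_trans (leq_bigmax_cond g incg).
Qed.

(** Laplace expansion along row 0 leaves a single term, a minor of [A] that avoids column [k]. This
    is how minors of order one below the number of columns enter. *)
Lemma det_unit_row_le_Delta (m n : nat) (A : 'M[int]_(m, n.+1)) (k : 'I_n.+1)
    (B : 'M[int]_n.+1) (c : int) (f : 'I_n -> 'I_m) :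
  `|c|%N = 1%N -> (forall j, B 0 j = c * (j == k)%:R) ->
  (forall i j, B (lift 0 i) j = A (f i) j) ->
  (`|\det B| <= Delta n A)%N.
Proof.
move=> c1 B0 Bf.
rewrite (expand_det_row B 0) (bigD1 k) //= big1 ?addr0 => [|j nejk]; last first.
  by rewrite B0 (negPf nejk) mulr0 mul0r.
rewrite B0 eqxx mulr1 /cofactor !abszM c1 mul1n abszX abszN1 exp1n mul1n.
pose g : {ffun 'I_n -> 'I_n.+1} := [ffun j => lift k j].
have -> : row' 0 (col' k B) = mxsub f g A.
  by apply/matrixP=> i j; rewrite !mxE ffunE Bf.
apply: det_mxsub_le_Delta.
apply/forallP=> i; apply/forallP=> j; apply/implyP=> ltij; rewrite !ffunE.
by rewrite /= /bump; move: (i : nat) (j : nat) ltij => a b; lia.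
Qed.

(** * Splitting vectors along faces *)

Lemma mx11D (V : nmodType) (B C : 'M[V]_1) : (B + C) 0 0 = B 0 0 + C 0 0.
Proof. by rewrite mxE. Qed.

Lemma mx11B (V : zmodType) (B C : 'M[V]_1) : (B - C) 0 0 = B 0 0 - C 0 0.
Proof. by rewrite !mxE. Qed.

Lemma mx11Z (V : pzRingType) a (B : 'M[V]_1) : (a *: B) 0 0 = a * B 0 0.
Proof. by rewrite mxE. Qed.

Section Cones.
Variables (R : realFieldType) (m n : nat) (M : 'M[R]_(n, m)).
Implicit Types (x y v d q : 'rV[R]_n) (S : {set 'I_m}).

Definition ev x i : R := (x *m M) 0 i.

Lemma evD x y i : ev (x + y) i = ev x i + ev y i.
Proof. by rewrite /ev mulmxDl mxE. Qed.
Lemma evZ a x i : ev (a *: x) i = a * ev x i.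
Proof. by rewrite /ev -scalemxAl mxE. Qed.
Lemma evB x y i : ev (x - y) i = ev x i - ev y i.
Proof. by rewrite -scaleN1r evD evZ mulN1r. Qed.
Lemma ev0 i : ev 0 i = 0.
Proof. by rewrite /ev mul0mx mxE. Qed.

Definition kerS S : 'M[R]_n := (\bigcap_(i in S) kermx (col i M))%MS.
(** The rank of [kerS (zset x)] is the dimension of the cone of all [y] for which each [ev y i] is a
    nonnegative multiple of [ev x i]; [x] lies in the relative interior of this cone. *)
Definition zset x : {set 'I_m} := [set i | ev x i == 0].

Lemma ev_kermx x i : (x <= kermx (col i M))%MS = (ev x i == 0).
Proof.
have evE : x *m col i M = (ev x i)%:M.
  apply/rowP => j; rewrite ord1 /ev !mxE mulr1n.
  by apply: eq_bigr => k _; rewrite !mxE.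
apply/sub_kermxP/eqP => [|xi0]; last by rewrite evE xi0 raddf0.
by rewrite evE => /rowP/(_ 0); rewrite !mxE mulr1n.
Qed.

Lemma kerSP S x : reflect (forall i, i \in S -> ev x i = 0) (x <= kerS S)%MS.
Proof.
apply: (iffP sub_bigcapmxP) => H i Si; first by apply/eqP; rewrite -ev_kermx H.
by rewrite ev_kermx H.
Qed.

Lemma kerS_sub S S' : S \subset S' -> (kerS S' <= kerS S)%MS.
Proof.
move=> /subsetP sSS'; apply/rV_subP => u /kerSP Hu.
by apply/kerSP => i /sSS'; apply: Hu.
Qed.

Lemma kerS_rank_lt S x i : (x <= kerS S)%MS -> ev x i != 0 ->
  (\rank (kerS (i |: S)) < \rank (kerS S))%N.
Proof.
move=> xS xi; apply: rank_ltmx; rewrite ltmxE kerS_sub ?subsetUr //=.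
apply/negP => sub; have /kerSP/(_ i) := submx_trans xS sub.
by rewrite setU11 => /(_ isT) xi0; rewrite xi0 eqxx in xi.
Qed.

Lemma rank_kerS_le S S' : S \subset S' ->
  (\rank (kerS S') <= \rank (kerS S))%N.
Proof. by move=> sSS'; apply/mxrankS/kerS_sub. Qed.

Lemma sub_kerS_zset x S : S \subset zset x -> (x <= kerS S)%MS.
Proof. by move=> /subsetP s; apply/kerSP => i /s; rewrite inE => /eqP. Qed.

(** For [S = setT] this says that [y] is a part of [x]. A smaller [S] relaxes the cone, whose
    lineality space becomes [kerS S]. *)
Definition frac S y x : Prop :=
  forall i, i \in S -> exists2 r, 0 <= r <= 1 & ev y i = r * ev x i.

Lemma frac_refl S x : frac S x x.
Proof. by move=> i _; exists 1; rewrite ?mul1r ?ler01 ?lexx. Qed.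

Lemma frac_trans S y x z : frac S y x -> frac S x z -> frac S y z.
Proof.
move=> yx xz i Si; have [r /andP[r0 r1] ->] := yx i Si.
have [s /andP[s0 s1] ->] := xz i Si.
by exists (r * s); rewrite ?mulrA // mulr_ge0 //= mulr_ile1.
Qed.

Lemma frac_subl S y x : frac S y x -> frac S (x - y) x.
Proof.
move=> yx i Si; have [r /andP[r0 r1] E] := yx i Si.
by exists (1 - r); [apply/andP; split; lra | rewrite evB E; ring].
Qed.

(** Some direction [d] of the face of [x] is not a multiple of [x] modulo [kerS S], so its ratios to
    [x] on the constraints are not constant. Subtracting a multiple of [x] and rescaling makes the
    ratios run from 0 to 1: [y] gains a zero at the smallest ratio, [x - y] at the largest. *)
Lemma frac_split S x :
  (\rank (kerS S) + 2 <= \rank (kerS (S :&: zset x)))%N ->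
  exists y, [/\ frac S y x,
    (\rank (kerS (S :&: zset y)) < \rank (kerS (S :&: zset x)))%N &
    (\rank (kerS (S :&: zset (x - y))) < \rank (kerS (S :&: zset x)))%N].
Proof.
set Z := S :&: zset x => rk.
have : ~~ (kerS Z <= kerS S + x)%MS.
  apply/negP => /mxrankS; have := mxrank_adds_leqif (kerS S) x.
  by move/leqifP; have := rank_leq_row x; case: ifP => _; lia.
case/row_subPn => k; set d := row k _ => dN.
have dZ : (d <= kerS Z)%MS by apply: row_sub.
have xZ : (x <= kerS Z)%MS by apply/sub_kerS_zset/subsetIr.
pose T := S :\: zset x; pose rho i := ev d i / ev x i.
have TS i : i \in T -> i \in S by rewrite inE => /andP[].
have xT i : i \in T -> ev x i != 0 by rewrite !inE => /andP[].
have rhoE i : i \in T -> ev d i = rho i * ev x i.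
  by move=> iT; rewrite /rho divfK ?xT.
have zE i : i \in S -> i \notin T -> ev d i = 0 /\ ev x i = 0.
  move=> iS; rewrite inE iS andbT negbK => iz.
  have iZ : i \in Z by rewrite inE iS.
  by split; [apply/(kerSP _ _ dZ) | apply/(kerSP _ _ xZ)].
have nonconst c : exists2 i, i \in T & rho i != c.
  have : ~~ (d - c *: x <= kerS S)%MS.
    apply: contra dN => dc; rewrite -[d](subrK (c *: x)).
    by apply: addmx_sub_adds => //; apply: scalemx_sub.
  move=> N; apply/exists_inP; apply: contraR N => /exists_inPn H.
  apply/kerSP => i Si; rewrite evB evZ.
  case: (boolP (i \in T)) => iT; last by have [-> ->] := zE i Si iT; ring.
  by rewrite rhoE //; have /eqP -> : rho i == c by [rewrite -[_ == _]negbK H]; ring.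
have [i0 i0T _] := nonconst 0.
pose lo := [arg min_(i < i0 in T) rho i]%O.
pose hi := [arg max_(i > i0 in T) rho i]%O.
have [loT loP] : lo \in T /\ forall j, j \in T -> rho lo <= rho j.
  by rewrite /lo; case: arg_minP.
have [hiT hiP] : hi \in T /\ forall j, j \in T -> rho j <= rho hi.
  by rewrite /hi; case: arg_maxP.
have lohi : rho lo < rho hi.
  have [j jT] := nonconst (rho lo); have := loP j jT; have := hiP j jT.
  by move=> jhi loj ne; apply: lt_le_trans jhi; rewrite lt_def ne.
pose e := rho hi - rho lo; have e0 : 0 < e by rewrite subr_gt0.
pose y := e^-1 *: (d - rho lo *: x).
have yE i : i \in T -> ev y i = ((rho i - rho lo) / e) * ev x i.
  by move=> iT; rewrite evZ evB evZ rhoE //; ring.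
have y0 i : i \in S -> i \notin T -> ev y i = 0.
  by move=> iS iT; have [E1 E2] := zE i iS iT; rewrite evZ evB evZ E1 E2; ring.
have fr : frac S y x.
  move=> i Si; case: (boolP (i \in T)) => iT; last first.
    by exists 0; rewrite ?lexx ?ler01 // mul0r y0.
  exists ((rho i - rho lo) / e); last exact: yE.
  rewrite divr_ge0 ?subr_ge0 ?loP ?(ltW e0) //= ler_pdivrMr // mul1r.
  by rewrite lerB ?hiP.
exists y; split => //.
- apply: leq_ltn_trans (kerS_rank_lt xZ (xT _ loT)); apply: rank_kerS_le.
  apply/subsetP => i; rewrite !inE => /orP[/eqP ->|/andP[iS iz]].
    by rewrite TS //= yE // subrr mul0r mul0r.
  by rewrite iS y0 ?eqxx // !inE iS iz.
- apply: leq_ltn_trans (kerS_rank_lt xZ (xT _ hiT)); apply: rank_kerS_le.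
  apply/subsetP => i; rewrite !inE => /orP[/eqP ->|/andP[iS iz]].
    have ee : e / e = 1 by rewrite divff ?gt_eqF.
    by rewrite TS //= evB yE // -/e ee mul1r subrr.
  by rewrite iS evB (eqP iz) y0 ?subrr ?eqxx // !inE iS iz.
Qed.

(** Split repeatedly. The values of [g] at the two pieces add up to a positive number, so one piece
    is again positive, and its dimension is smaller. *)
Lemma frac_extreme (g : 'cV[R]_n) S x : 0 < (x *m g) 0 0 ->
  exists y, [/\ frac S y x, 0 < (y *m g) 0 0 &
    (\rank (kerS (S :&: zset y)) <= (\rank (kerS S)).+1)%N].
Proof.
have [k] := ubnP (\rank (kerS (S :&: zset x))); elim: k x => // k IHk x.
rewrite ltnS => lek phix.
have [small|big] := leqP (\rank (kerS (S :&: zset x))) (\rank (kerS S)).+1.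
  by exists x; split => //; apply: frac_refl.
have [|y [fry lty ltxy]] := @frac_split S x; first by rewrite addn2.
have : 0 < (y *m g) 0 0 \/ 0 < ((x - y) *m g) 0 0.
  rewrite mulmxBl mx11B.
  case: (ltP 0 ((y *m g) 0 0)) => [|y0]; [by left | right].
  by rewrite subr_gt0; apply: le_lt_trans y0 _.
case=> pos.
  have [|z [frz phiz rkz]] := IHk y _ pos; first exact: leq_trans lty lek.
  by exists z; split => //; apply: frac_trans fry.
have [|z [frz phiz rkz]] := IHk (x - y) _ pos; first exact: leq_trans ltxy lek.
by exists z; split => //; apply: frac_trans (frac_subl fry).
Qed.

Hypothesis pointed : kerS setT = 0.

Lemma ev_inj x : (forall i, ev x i = 0) -> x = 0.
Proof.
move=> x0; apply/eqP; rewrite -submx0 -pointed.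
by apply/kerSP => i _; apply: x0.
Qed.

(** When [ev x i] is nonzero, [v] spans an extreme ray of the cone of [x] and is its largest
    multiple that is a part of [x]; [i] is a constraint that stops it. *)
Definition ray x v i : Prop := [/\ frac setT v x, ev v i = ev x i &
  (\rank (kerS (zset v)) <= 1)%N].

(** Both vectors span the same line, and their common value at [i] fixes the factor. So a given [i]
    has finitely many rays, at most one per zero set, and a maximum over them exists. *)
Lemma ray_zset_inj x v v' i : ev x i != 0 -> ray x v i -> ray x v' i ->
  zset v = zset v' -> v = v'.
Proof.
move=> xi [_ vi rkv] [_ v'i _] eqz.
have vK : (v <= kerS (zset v))%MS by apply: sub_kerS_zset.
have v'K : (v' <= kerS (zset v))%MS by apply: sub_kerS_zset; rewrite eqz.
have v0 : v != 0 by apply: contraNneq xi => v0; rewrite -vi v0 ev0.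
have : (kerS (zset v) <= v)%MS.
  by have [_ <-] := mxrank_leqif_sup vK; rewrite eqn_leq mxrankS // rank_rV v0.
move=> /(submx_trans v'K) /sub_rVP[a def_v'].
have /eqP := v'i; rewrite def_v' evZ vi -subr_eq0 -{2}[ev x i]mul1r -mulrBl.
by rewrite mulf_eq0 (negPf xi) orbF subr_eq0 => /eqP ->; rewrite scale1r.
Qed.

(** The functional [x^T] is positive at [x], hence at some extreme ray [y]; dividing by the largest
    ratio of [y] to [x] makes that ratio 1. *)
Lemma ray_exists x : x != 0 -> exists i v, ev x i != 0 /\ ray x v i.
Proof.
move=> x0.
have xx : 0 < (x *m x^T) 0 0.
  rewrite mxE; under eq_bigr do rewrite mxE -expr2.
  rewrite lt_neqAle sumr_ge0 ?andbT => [|j _]; last exact: sqr_ge0.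
  apply: contraNneq x0 => /esym/eqP; rewrite psumr_eq0 => [/allP H|j _]; last exact: sqr_ge0.
  apply/eqP/rowP => j; rewrite mxE; apply/eqP; rewrite -sqrf_eq0.
  exact: H (mem_index_enum j).
have [y [fry ypos rky]] := frac_extreme setT xx.
rewrite pointed mxrank0 setTI in rky.
have [i yi] : exists i, ev y i != 0.
  apply/existsP; apply: contraTT ypos => /existsPn H.
  rewrite (_ : y = 0) ?mul0mx ?mxE ?ltxx //.
  by apply: ev_inj => i; apply/eqP; rewrite -[_ == _]negbK H.
have xi0 j : ev y j != 0 -> ev x j != 0.
  by apply: contraNneq => xj0; have [r _ ->] := fry j (in_setT j); rewrite xj0 mulr0.
pose rho j := ev y j / ev x j.
have rho_ge0 j : 0 <= rho j.
  have [r /andP[r0 _] E] := fry j (in_setT j); rewrite /rho E.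
  by case: (eqVneq (ev x j) 0) => [->|xj]; rewrite ?invr0 ?mulr0 // mulfK.
pose hi := [arg max_(j > i) rho j]%O.
have hiP j : rho j <= rho hi by rewrite /hi; case: arg_maxP => // k _; apply.
have rhohi : 0 < rho hi.
  apply: lt_le_trans (hiP i); rewrite lt_def rho_ge0 andbT.
  by rewrite mulf_neq0 ?invr_eq0 ?xi0.
have xhi : ev x hi != 0.
  by apply: contraTneq rhohi => xhi0; rewrite /rho xhi0 invr0 mulr0 ltxx.
exists hi, ((rho hi)^-1 *: y); split => //; split.
- move=> j _; exists (rho j / rho hi).
    by rewrite divr_ge0 ?(ltW rhohi) //= ler_pdivrMr // mul1r.
  rewrite evZ /rho mulrAC; case: (eqVneq (ev x j) 0) => [xj|xj].
    by have [r _ ->] := fry j (in_setT j); rewrite xj !mulr0 mul0r.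
  by rewrite divfK // mulrC.
- rewrite evZ /rho invf_div divfK //; move: rhohi; rewrite /rho.
  by case: eqVneq => // ->; rewrite mul0r ltxx.
- apply: leq_trans rky; apply: rank_kerS_le; apply/subsetP => j.
  by rewrite !inE evZ mulf_eq0 => ->; rewrite orbT.
Qed.

Lemma ray_argmax (phi : 'rV[R]_n -> R) x i v0 : ev x i != 0 -> ray x v0 i ->
  exists2 v, ray x v i & forall v', ray x v' i -> phi v' <= phi v.
Proof.
move=> xi ray0; pose P S := `[< exists2 v, ray x v i & zset v = S >].
have exw S : exists v, P S -> ray x v i /\ zset v = S.
  case: (boolP (P S)) => [/asboolP[v rv zv]|_]; first by exists v.
  by exists 0.
pose wit S := projT1 (cid (exw S)).
have witP S : P S -> ray x (wit S) i /\ zset (wit S) = S := projT2 (cid (exw S)).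
have P0 : P (zset v0) by apply/asboolP; exists v0.
case: (@arg_maxP _ _ _ (zset v0) P (fun S => phi (wit S)) P0) => S PS maxS.
have [rS zS] := witP S PS; exists (wit S) => // v' rv'.
have Pv' : P (zset v') by apply/asboolP; exists v'.
have [r' z'] := witP _ Pv'.
by rewrite -(ray_zset_inj xi r' rv' z'); apply: maxS.
Qed.

(* Any face of dimension at least 3 splits off a face of dimension at most 2:
   among the extreme rays [v] whose subtraction from [x] first meets a given
   facet [i], take the one that is farthest out and slide it, keeping
   constraint [i] tight, along a two-dimensional face until it is blocked. *)
Lemma peel x : (2 < \rank (kerS (zset x)))%N ->
  exists q, [/\ frac setT q x, (\rank (kerS (zset q)) <= 2)%N &
    (\rank (kerS (zset (x - q))) <= \rank (kerS (zset x)) - 2)%N].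
Proof.
move=> dimx; have x0 : x != 0.
  apply: contraTneq dimx => ->; rewrite (_ : zset 0 = setT) ?pointed ?mxrank0 //.
  by apply/setP => j; rewrite !inE ev0 eqxx.
have [i [v0 [xi ray0]]] := ray_exists x0.
(* [g] adds up the ratios to [x] and is thus positive on nonzero parts of [x]. Since the inverse of
   0 is 0, constraints vanishing at [x] do not contribute. *)
pose g := \sum_j (ev x j)^-1 *: col j M.
pose rho y j := ev y j / ev x j.
have gE y : (y *m g) 0 0 = \sum_j rho y j.
  rewrite mulmx_sumr summxE; apply: eq_bigr => j _.
  rewrite -scalemxAr mxE /rho /ev mulrC; congr (_ / _).
  by rewrite !mxE; apply: eq_bigr => l _; rewrite !mxE.
have [v [frv vi rkv] vmax] := ray_argmax (fun y => (y *m g) 0 0) xi ray0.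
have xZ : (x <= kerS (zset x))%MS by apply: sub_kerS_zset.
have rki : (\rank (kerS (i |: zset x)) < \rank (kerS (zset x)))%N.
  exact: kerS_rank_lt xZ xi.
have frac_rho y : frac setT y x -> forall j, 0 <= rho y j <= 1 /\ ev y j = rho y j * ev x j.
  move=> fry j; have [r r01 E] := fry j (in_setT j); rewrite /rho E.
  by case: (eqVneq (ev x j) 0) => [->|xj]; rewrite ?invr0 ?mulr0 ?lexx ?ler01 // mulfK.
have zsub y : frac setT y x -> zset x \subset zset y.
  move=> fry; apply/subsetP => j; rewrite !inE => /eqP xj.
  by have [_ ->] := frac_rho y fry j; rewrite xj mulr0.
(* If [q] meets [x] at two constraints that are independent on the face of [x], then [x - q] loses
   two dimensions. *)
have close q j : frac setT q x -> ev q i = ev x i -> ev q j = ev x j ->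
    ~~ (kerS (i |: zset x) <= kermx (col j M))%MS ->
    (\rank (kerS (zset (x - q))) <= \rank (kerS (zset x)) - 2)%N.
  move=> frq qi qj /row_subPn[l]; set y := row l _ => yj.
  have yK : (y <= kerS (i |: zset x))%MS by apply: row_sub.
  have rkj : (\rank (kerS (j |: (i |: zset x))) < \rank (kerS (i |: zset x)))%N.
    by apply: kerS_rank_lt yK _; rewrite -ev_kermx.
  have : (\rank (kerS (zset (x - q))) <= \rank (kerS (j |: (i |: zset x))))%N.
    apply: rank_kerS_le; apply/subsetP => k; rewrite !inE evB.
    case/or3P => [/eqP ->|/eqP ->|xk]; rewrite ?qi ?qj ?subrr //.
    by have /subsetP/(_ k) := zsub q frq; rewrite !inE (eqP xk) sub0r oppr_eq0 => ->.
  lia.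
case: (boolP [exists j, (ev v j == ev x j) &&
    ~~ (kerS (i |: zset x) <= kermx (col j M))%MS]) => [/existsP[j /andP[/eqP vj nj]]|].
  by exists v; split; [|lia|apply: close vj nj].
move=> /existsPn caseB.
have stay y j : (y <= kerS (i |: zset x))%MS -> ev v j = ev x j -> ev y j = 0.
  move=> yK vj; apply/eqP; rewrite -ev_kermx; apply: submx_trans yK _.
  by have := caseB j; rewrite vj eqxx /= negbK.
pose f := x - v.
have fpos : 0 < (f *m g) 0 0.
  rewrite gE lt_neqAle sumr_ge0 ?andbT => [|j _]; last first.
    by have [/andP[]] := frac_rho f (frac_subl frv) j.
  apply/eqP => /esym/eqP; rewrite psumr_eq0 => [/allP f0|j _]; last first.
    by have [/andP[]] := frac_rho f (frac_subl frv) j.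
  have /eqP : f = 0.
    apply: ev_inj => j; have [_ ->] := frac_rho f (frac_subl frv) j.
    by have /eqP -> := f0 j (mem_index_enum j); rewrite mul0r.
  by rewrite subr_eq0 => /eqP xv; move: rkv; rewrite -xv; lia.
(* [h] is [g] after projection along [v] onto [ev _ i = 0]. Its positivity at [y] means that the
   direction [d] below increases [g] while keeping [i] tight. *)
pose h := g - (((v *m g) 0 0) / ev x i) *: col i M.
have hE y : (y *m h) 0 0 = ((y - rho y i *: v) *m g) 0 0.
  rewrite /h mulmxBr mulmxBl -scalemxAr -scalemxAl.
  rewrite !mx11B !mx11Z; congr (_ - _).
  have -> : (y *m col i M) 0 0 = ev y i.
    by rewrite /ev !mxE; apply: eq_bigr => l _; rewrite !mxE.
  by rewrite /rho; ring.
have hpos : 0 < (f *m h) 0 0.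
  by rewrite hE /rho /f evB vi subrr mul0r scale0r subr0.
have [y [fry ypos rky]] := frac_extreme (zset v) hpos.
rewrite hE in ypos; set d := y - _ in ypos.
have rkvy : (\rank (kerS (zset v :&: zset y)) <= 2)%N by lia.
have di : ev d i = 0 by rewrite evB evZ vi /rho divfK // subrr.
have dv j : j \in zset v -> exists2 r, 0 <= r & ev d j = r * ev x j.
  move=> jv; have [r /andP[r0 _] yj] := fry j jv; exists r => //.
  by move: jv; rewrite inE => /eqP vj; rewrite evB evZ yj evB vj mulr0 !subr0.
have dK : (d <= kerS (i |: zset x))%MS.
  apply/kerSP => j; rewrite !inE => /orP[/eqP -> //|/eqP xj].
  have [|r _ ->] := dv j; last by rewrite xj mulr0.
  by apply: (subsetP (zsub v frv)); rewrite inE xj.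
have rho_v j : ev x j != 0 -> rho d j < 0 -> 0 < rho v j.
  move=> xj dj; have [/andP[v0' _] vE] := frac_rho v frv j.
  rewrite lt_def v0' andbT; apply: contraTneq dj => vj0.
  have [|r r0 E] := dv j; first by rewrite inE vE vj0 mul0r.
  by rewrite /rho E mulfK // -leNgt.
(* The step along [d] at which the ratio at [j], starting from [v], reaches 1 or 0. *)
pose t j := if 0 < rho d j then (1 - rho v j) / rho d j else rho v j / - rho d j.
have [j0 dj0] : exists j, rho d j != 0.
  apply/existsP; apply: contraTT ypos => /existsPn d0.
  by rewrite gE big1 ?ltxx // => j _; apply/eqP; rewrite -[_ == _]negbK d0.
pose js := [arg min_(j < j0 | rho d j != 0) t j]%O.
have [djs tmin] : rho d js != 0 /\ forall j, rho d j != 0 -> t js <= t j.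
  by rewrite /js; case: arg_minP.
have xjs : ev x js != 0 by apply: contraNneq djs => E; rewrite /rho E invr0 mulr0.
have t_ge0 : 0 <= t js.
  have [/andP[v0' v1] _] := frac_rho v frv js.
  by rewrite /t; case: ltP => d0; apply: divr_ge0; rewrite ?subr_ge0 ?oppr_ge0 // ltW.
pose q := v + t js *: d.
have rhoq j : rho q j = rho v j + t js * rho d j.
  by rewrite /rho evD evZ; ring.
have evq j : ev q j = rho q j * ev x j.
  case: (eqVneq (ev x j) 0) => [xj|xj]; last by rewrite /rho divfK.
  have jx : j \in zset x by rewrite inE xj.
  rewrite xj mulr0 evD evZ (kerSP _ _ dK) ?setU1r // mulr0 addr0.
  by apply/eqP; have := subsetP (zsub v frv) _ jx; rewrite inE.
have frq : frac setT q x.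
  move=> j _; exists (rho q j); last exact: evq.
  have [/andP[v0' v1] _] := frac_rho v frv j; rewrite rhoq.
  have [dj|dj|->] := ltgtP (rho d j) 0; last by rewrite mulr0 addr0 v0' v1.
  - have := tmin j; rewrite {2}/t ltNge (ltW dj) /= lt_eqF // => /(_ isT).
    rewrite ler_pdivlMr ?oppr_gt0 // => tj; apply/andP; split; nra.
  - have := tmin j; rewrite {2}/t dj gt_eqF // => /(_ isT).
    rewrite ler_pdivlMr // => tj; apply/andP; split; nra.
have qi : ev q i = ev x i by rewrite evD evZ di mulr0 addr0.
have [djsn|djsp|E] := ltgtP (rho d js) 0; last by rewrite E eqxx in djs.
(* Blocked by a ratio falling to 0: [q] would be a ray for [i] with a larger value of [g], against
   the choice of [v]. *)
- have qjs : ev q js = 0.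
    rewrite evq rhoq {1}/t ltNge (ltW djsn) /= invrN mulrN mulNr divfK //.
    by rewrite subrr mul0r.
  have vjs := rho_v js xjs djsn.
  have rayq : ray x q i.
    split => //; rewrite -ltnS; apply: leq_trans rkvy.
    apply: leq_ltn_trans (_ : (\rank (kerS (js |: (zset v :&: zset y))) < _)%N).
      apply: rank_kerS_le; apply/subsetP => j; rewrite !inE.
      case/orP => [/eqP ->|/andP[/eqP vj /eqP yj]]; first exact/eqP.
      by rewrite evD evZ evB evZ vj yj; apply/eqP; ring.
    apply: (@kerS_rank_lt _ v); first by apply/sub_kerS_zset/subsetIl.
    by apply: contraTneq vjs => E; rewrite /rho E mul0r ltxx.
  have := vmax q rayq; rewrite mulmxDl -scalemxAl mx11D mx11Z gerDl.
  have tpos : 0 < t js.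
    by rewrite /t [0 < rho d js]ltNge (ltW djsn) /= divr_gt0 ?oppr_gt0.
  by rewrite leNgt mulr_gt0.
(* Blocked by a ratio reaching 1: [q] meets [x] at [js] as well as at [i], and [d] witnesses their
   independence. *)
- exists q; split => //.
    apply: leq_trans rkvy; apply: rank_kerS_le; apply/subsetP => j; rewrite !inE.
    case/andP => /eqP vj /eqP yj.
    by rewrite evD evZ evB evZ vj yj; apply/eqP; ring.
  apply: (close q js) => //.
    by rewrite evq rhoq {1}/t djsp divfK // addrCA subrr addr0 mul1r.
  apply/negP => /(submx_trans dK); rewrite ev_kermx => E.
  by rewrite /rho (eqP E) mul0r eqxx in djs.
Qed.

End Cones.

(** * Frames of rows with maximal determinant *)

(** In the Leibniz formula only the identity and the transposition of [i1] and [i2] survive: any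
    other permutation moves an index whose row is a unit row. *)
Lemma det_two_rows (R : comNzRingType) n (C : 'M[R]_n) (i1 i2 : 'I_n) :
  i1 != i2 -> (forall i j, i != i1 -> i != i2 -> C i j = (i == j)%:R) ->
  \det C = C i1 i1 * C i2 i2 - C i1 i2 * C i2 i1.
Proof.
move=> ne12 CE; have neq : tperm i1 i2 != 1%g.
  by apply: contra_neq ne12 => /permP/(_ i1); rewrite tpermL perm1.
rewrite /determinant (bigD1 (1%g : 'S_n)) //= (bigD1 (tperm i1 i2)) //=.
rewrite [X in _ + (_ + X)]big1 ?addr0 => [|s /andP[s1 s12]]; last first.
  have [i [ni1 ni2 si]] : exists i, [/\ i != i1, i != i2 & s i != i].
    apply: contrapT => H; have fix_s i : i != i1 -> i != i2 -> s i = i.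
      by move=> ? ?; apply: contrapT => /eqP si; apply: H; exists i.
    have s_in i : (i == i1) || (i == i2) -> (s i == i1) || (s i == i2).
      apply: contraTT; rewrite !negb_or => /andP[n1 n2].
      have := fix_s _ n1 n2 => /perm_inj E; rewrite E in n1 n2.
      by rewrite n1 n2.
    have := s_in i1; rewrite eqxx => /(_ isT) /orP[] /eqP E1.
      move/negP: s1; apply; apply/eqP/permP => i; rewrite perm1.
      have [->//|n1] := eqVneq i i1; have [->|n2] := eqVneq i i2; last exact: fix_s.
      have := s_in i2; rewrite eqxx orbT => /(_ isT) /orP[] /eqP E2 //.
      by move: ne12; rewrite (perm_inj (etrans E1 (esym E2))) eqxx.
    move/negP: s12; apply; apply/eqP/permP => i.
    have [->|n1] := eqVneq i i1; first by rewrite tpermL.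
    have [->|n2] := eqVneq i i2; last by rewrite tpermD 1?eq_sym // fix_s.
    have := s_in i2; rewrite eqxx orbT tpermR => /(_ isT) /orP[] /eqP E2 //.
    by move: ne12; rewrite (perm_inj (etrans E1 (esym E2))) eqxx.
  by rewrite (bigD1 i) //= CE // eq_sym (negPf si) mul0r mulr0.
rewrite odd_perm1 odd_tperm ne12 expr0 expr1 mul1r mulN1r.
have prodE (s : 'S_n) : (forall i, i != i1 -> i != i2 -> s i = i) ->
    \prod_i C i (s i) = C i1 (s i1) * C i2 (s i2).
  move=> fix_s; rewrite (bigD1 i1) //= (bigD1 i2) 1?eq_sym //= big1 ?mulr1 //.
  by move=> i /andP[n1 n2]; rewrite CE // fix_s // eqxx.
rewrite prodE ?perm1 => [|i]; last by rewrite perm1.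
by rewrite prodE ?tpermL ?tpermR // => i *; rewrite tpermD 1?eq_sym.
Qed.

Section Frame.
Variables (R : realFieldType) (m n : nat) (A : 'M[int]_(m, n.+1)) (al : 'rV[int]_n.+1).

Definition rmat : 'M[R]_(n.+1, m) := (map_mx intr A)^T.
Definition ralpha (x : 'rV[R]_n.+1) : R := (x *m (map_mx intr al)^T) 0 0.
Definition basis (f : 'I_n -> 'I_m) : 'M[int]_n.+1 :=
  \matrix_(i, j) oapp (fun k => A (f k) j) (al 0 j) (unlift 0 i).

Hypothesis pointed : kerS rmat setT = 0.

Lemma ralphaB x y : ralpha (x - y) = ralpha x - ralpha y.
Proof. by rewrite /ralpha mulmxBl mx11B. Qed.
Lemma ralphaZ a x : ralpha (a *: x) = a * ralpha x.
Proof. by rewrite /ralpha -scalemxAl mx11Z. Qed.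

(** Greedy choice: while the target rank is not reached, some row of [S] cuts the current space
    further. Once it is reached, any row of [S] pads the list. *)
Lemma ker_cut (V : 'M[R]_n.+1) S t :
  (\rank (V :&: kerS rmat S)%MS + t <= \rank V)%N ->
  exists s : seq 'I_m, [/\ size s = t, {subset s <= S} &
    (\rank (V :&: kerS rmat [set i in s])%MS <= \rank V - t)%N].
Proof.
elim: t => [|t IHt] le_t; first by exists [::]; split; rewrite ?subn0 // mxrankS ?capmxSl.
have [|s [sz sS rs]] := IHt; first by lia.
have : (\rank (V :&: kerS rmat S)%MS + t < \rank V)%N by lia.
set W := (V :&: kerS rmat [set i in s])%MS in rs *; move=> ltt.
have [WS|nWS] := boolP (\rank W <= \rank V - t.+1)%N.
  have [i iS|noS] := pickP (mem S).
    exists (i :: s); split; first by rewrite /= sz.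
      by move=> j; rewrite inE => /orP[/eqP -> //|/sS].
    apply: leq_trans WS; apply: mxrankS; apply: capmxS => //; apply: kerS_sub.
    by apply/subsetP => j; rewrite !inE orbC => ->.
  have S0 : S = set0 by apply/setP => j; rewrite inE; apply: noS.
  have : (V <= kerS rmat S)%MS.
    by apply/rV_subP => u _; apply/kerSP => j; rewrite S0 inE.
  by move=> /capmx_idPl [eqr _]; move: le_t; rewrite eqr; lia.
have : ~~ (W <= kerS rmat S)%MS.
  apply: contra nWS => WS; have : (W <= V :&: kerS rmat S)%MS by rewrite sub_capmx capmxSl.
  by move/mxrankS; lia.
case/row_subPn => k; set y := row k W => yS.
have yW : (y <= W)%MS by apply: row_sub.
have [i iS yi] : exists2 i, i \in S & ev rmat y i != 0.
  apply/exists_inP; apply: contraR yS => /exists_inPn H.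
  by apply/kerSP => i iS; apply/eqP; rewrite -[_ == _]negbK H.
exists (i :: s); split; first by rewrite /= sz.
  by move=> j; rewrite inE => /orP[/eqP -> //|/sS].
suff : (\rank (V :&: kerS rmat [set j in i :: s])%MS < \rank W)%N.
  by move/leq_trans/(_ rs); rewrite subnS; case: (_ - _)%N.
apply: rank_ltmx; rewrite ltmxE; apply/andP; split.
  apply: capmxS => //; apply: kerS_sub; apply/subsetP => j.
  by rewrite !inE orbC => ->.
apply/negP => /(submx_trans yW); rewrite sub_capmx => /andP[_ /kerSP/(_ i)].
by rewrite !inE eqxx => /(_ isT) yi0; rewrite yi0 eqxx in yi.
Qed.

Lemma basis0 (f : 'I_n -> 'I_m) (x : 'rV[R]_n.+1) :
  (x *m (map_mx intr (basis f))^T) 0 0 = ralpha x.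
Proof.
by rewrite /ralpha !mxE; apply: eq_bigr => l _; rewrite !mxE unlift_none.
Qed.

Lemma basis_lift (f : 'I_n -> 'I_m) (x : 'rV[R]_n.+1) i :
  (x *m (map_mx intr (basis f))^T) 0 (lift 0 i) = ev rmat x (f i).
Proof.
by rewrite /ev !mxE; apply: eq_bigr => l _; rewrite !mxE liftK.
Qed.

(** The hyperplane [al = 0] has dimension [n] and misses [q], so it meets [kerS Z] in dimension at
    most [r]. Hence [n - r] rows of [Z] cut it down to dimension [r], and at most [r] more rows cut
    it down to 0. The rows of [Z] occupy the positions from [r] on. *)
Lemma basis_exists (Z : {set 'I_m}) (q : 'rV[R]_n.+1) r :
  (r <= n)%N -> (\rank (kerS rmat Z) <= r.+1)%N -> (q <= kerS rmat Z)%MS ->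
  ralpha q != 0 ->
  exists f : {ffun 'I_n -> 'I_m},
    (forall i : 'I_n, (r <= i)%N -> f i \in Z) /\ \det (basis f) != 0.
Proof.
move=> rn rkZ qZ aq.
pose V := kermx (map_mx intr al : 'rV[R]_n.+1)^T.
have VP x : (x <= V)%MS = (ralpha x == 0).
  apply/sub_kermxP/eqP => [H|H]; first by rewrite /ralpha H mxE.
  by apply/rowP => j; rewrite ord1 [RHS]mxE.
have al0 : (map_mx intr al : 'rV[R]_n.+1) != 0.
  by apply: contraNneq aq => al0; rewrite /ralpha al0 trmx0 mulmx0 mxE.
have rkV : \rank V = n by rewrite mxrank_ker mxrank_tr rank_rV al0 subn1.
have rkVZ : (\rank (V :&: kerS rmat Z)%MS <= r)%N.
  rewrite -ltnS; apply: leq_trans rkZ; apply: rank_ltmx.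
  rewrite ltmxE capmxSr /=; apply: contra aq => /(submx_trans qZ).
  by rewrite sub_capmx VP => /andP[].
have [|s1 [sz1 s1Z rk1]] := @ker_cut V Z (n - r); first by lia.
set V1 := (V :&: _)%MS in rk1.
have [|s2 [sz2 _ rk2]] := @ker_cut V1 setT (\rank V1).
  by rewrite pointed capmx0 mxrank0.
have [i0 _|no] := pickP (mem [set: 'I_m]); last first.
  have : (kerS rmat setT :=: 1%:M)%MS.
    rewrite /kerS big_pred0 //; exact: no.
  by rewrite pointed => -[]; rewrite mxrank0 mxrank1.
pose s3 := s2 ++ nseq (r - size s2) i0.
have sz3 : size s3 = r by rewrite size_cat size_nseq; lia.
exists [ffun i : 'I_n => nth i0 (s3 ++ s1) i]; split.
  move=> i ri; rewrite ffunE nth_cat sz3 ltnNge ri /=.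
  by apply: s1Z; apply: mem_nth; rewrite sz1; have := ltn_ord i; lia.
set f := [ffun i => _].
suff : (map_mx intr (basis f) : 'M[R]_n.+1)^T \in unitmx.
  rewrite unitmxE det_tr det_map_mx unitfE; apply: contraNneq => ->.
  by rewrite rmorph0.
rewrite -row_free_unit -kermx_eq0; apply/eqP/row_matrixP => k; rewrite row0.
have : (row k (kermx (map_mx intr (basis f) : 'M[R]_n.+1)^T) <=
  kermx (map_mx intr (basis f) : 'M[R]_n.+1)^T)%MS by apply: row_sub.
move: (row k _) => x /sub_kermxP xB.
have evf i : ev rmat x (f i) = 0 by rewrite -basis_lift xB mxE.
have evs j : j \in s2 ++ s1 -> ev rmat x j = 0.
  move=> js; have js' : j \in s3 ++ s1.
    by move: js; rewrite !mem_cat => /orP[->|->]; rewrite ?orbT.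
  have lti : (index j (s3 ++ s1) < n)%N.
    by move: js'; rewrite -index_mem size_cat sz3 sz1; lia.
  by have := evf (Ordinal lti); rewrite ffunE /= nth_index.
apply/eqP; rewrite -submx0; apply: submx_trans (_ : (x <= V1 :&: kerS rmat [set i in s2])%MS) _.
  rewrite sub_capmx /V1 sub_capmx VP -andbA; apply/and3P; split.
  - by rewrite -(basis0 f) xB mxE.
  - by apply/kerSP => j; rewrite inE => js; rewrite evs // mem_cat js orbT.
  - by apply/kerSP => j; rewrite inE => js; rewrite evs // mem_cat js.
by move: rk2; rewrite subnn leqn0 mxrank_eq0 => /eqP ->.
Qed.

(* [f] maximises the determinant, so by Cramer's rule exchanging one or two of
   its first [r] rows bounds the coefficients and their 2x2 minors by 1. *)
Lemma frame (Z : {set 'I_m}) (q : 'rV[R]_n.+1) r :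
  (r <= n)%N -> (\rank (kerS rmat Z) <= r.+1)%N -> (q <= kerS rmat Z)%MS ->
  ralpha q != 0 ->
  exists (f : {ffun 'I_n -> 'I_m}) (c : 'I_m -> 'I_n -> R),
  [/\ \det (basis f) != 0, forall i : 'I_n, (r <= i)%N -> f i \in Z,
      forall h e, ralpha e = 0 ->
        (forall i : 'I_n, (r <= i)%N -> ev rmat e (f i) = 0) ->
        ev rmat e h = \sum_(i < n | (i < r)%N) c h i * ev rmat e (f i),
      forall h (i : 'I_n), (i < r)%N -> `|c h i| <= 1 &
      forall h h' (i i' : 'I_n), (i < r)%N -> (i' < r)%N -> i != i' ->
        `|c h i * c h' i' - c h i' * c h' i| <= 1].
Proof.
move=> rn rkZ qZ aq; have [f0 [f0Z det0]] := basis_exists rn rkZ qZ aq.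
pose P (f : {ffun 'I_n -> 'I_m}) := [forall i : 'I_n, (r <= i)%N ==> (f i \in Z)].
have Pf0 : P f0 by apply/forallP => i; apply/implyP => /f0Z.
case: (@arg_maxnP _ f0 P (fun f => `|\det (basis f)|%N) Pf0) => f Pf fmax.
have fZ (i : 'I_n) : (r <= i)%N -> f i \in Z by apply/implyP/(forallP Pf).
have detf : \det (basis f) != 0.
  by rewrite -absz_gt0; apply: leq_trans (fmax f0 Pf0); rewrite absz_gt0.
pose B : 'M[R]_n.+1 := map_mx intr (basis f).
have detB : \det B = (\det (basis f))%:~R by rewrite det_map_mx.
have uB : B \in unitmx by rewrite unitmxE detB unitfE intr_eq0.
pose AR : 'M[R]_(m, n.+1) := map_mx intr A.
pose cc h := row h AR *m invmx B.
have ccf i : cc (f i) = delta_mx 0 (lift 0 i).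
  rewrite /cc (_ : row (f i) AR = row (lift 0 i) B) -?row_mul ?mulmxV ?row1 //.
  by apply/rowP => j; rewrite !mxE liftK.
exists f, (fun h i => cc h 0 (lift 0 i)).
have expand h e : ev rmat e h =
    cc h 0 0 * ralpha e + \sum_i cc h 0 (lift 0 i) * ev rmat e (f i).
  have -> : ev rmat e h = (row h AR *m e^T) 0 0.
    by rewrite /ev !mxE; apply: eq_bigr => l _; rewrite !mxE mulrC.
  have -> : row h AR = cc h *m B by rewrite /cc mulmxKV.
  rewrite -mulmxA mxE big_ord_recl -(basis0 f) -/B; congr (_ * _ + _).
    by rewrite !mxE; apply: eq_bigr => l _; rewrite !mxE mulrC.
  apply: eq_bigr => i _; rewrite -(basis_lift f) -/B; congr (_ * _).
  by rewrite !mxE; apply: eq_bigr => l _; rewrite !mxE mulrC.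
(* [C] expresses the exchanged frame in the old one, so its determinant is a quotient of two frame
   determinants, at most 1 in absolute value by maximality. All its rows but [i1] and [i2] are unit
   rows. *)
have repl f' (i1 i2 : 'I_n.+1) : P f' -> i1 != i2 ->
    (forall i, lift 0 i != i1 -> lift 0 i != i2 -> f' i = f i) ->
    let C := (map_mx intr (basis f') : 'M[R]_n.+1) *m invmx B in
    [/\ forall j, C 0 j = (0 == j)%:R, forall i j, C (lift 0 i) j = cc (f' i) 0 j &
    `|C i1 i1 * C i2 i2 - C i1 i2 * C i2 i1| <= 1].
  move=> Pf' ne12 Hf' C.
  have C0 j : C 0 j = (0 == j)%:R.
    have -> : C 0 j = row 0 C 0 j by rewrite [RHS]mxE.
    rewrite row_mul (_ : row 0 _ = row 0 B); last first.
      by apply/rowP => l; rewrite !mxE !unlift_none.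
    by rewrite -row_mul mulmxV // !mxE.
  have Cl i j : C (lift 0 i) j = cc (f' i) 0 j.
    have -> : C (lift 0 i) j = row (lift 0 i) C 0 j by rewrite [RHS]mxE.
    rewrite row_mul /cc (_ : row (lift 0 i) _ = row (f' i) AR) //.
    by apply/rowP => l; rewrite !mxE liftK.
  split=> //.
  rewrite -det_two_rows // => [|i j ni1 ni2]; last first.
    case: (unliftP 0 i) => [i'|] E; last by rewrite E C0.
    by rewrite E in ni1 ni2 *; rewrite Cl Hf' // ccf mxE eqxx eq_sym.
  rewrite det_mulmx det_inv detB det_map_mx normrM normfV ler_pdivrMr; last first.
    by rewrite normr_gt0 intr_eq0.
  by rewrite mul1r -!intr_norm ler_int -!abszE lez_nat; apply: fmax.
have PfE (f' : {ffun 'I_n -> 'I_m}) :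
    (forall i : 'I_n, (r <= i)%N -> f' i = f i) -> P f'.
  by move=> H; apply/forallP => i; apply/implyP => ri; rewrite H ?fZ.
split=> //.
- move=> h e ae fe; rewrite expand ae mulr0 add0r [RHS]big_mkcond /=.
  by apply: eq_bigr => i _; case: ltnP => // /fe ->; rewrite mulr0.
(* Row 0 is always [al]; taking it as the second exchanged row reduces the minor to one
   coefficient. *)
- move=> h i ir; pose f' := [ffun k => if k == i then h else f k].
  have [|||C0 Cl bd] := @repl f' (lift 0 i) 0.
  + by apply: PfE => k rk; rewrite ffunE; case: eqP => // E; move: ir; rewrite -E; lia.
  + by [].
  + by move=> k; rewrite ffunE (inj_eq lift_inj) => /negPf ->.
  move: bd; rewrite C0 !Cl C0 eqxx mulr1 ffunE eqxx.
  by rewrite (_ : (0 == lift 0 i) = false) // mulr0 subr0.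
- move=> h h' i i' ir i'r ne.
  pose f' := [ffun k => if k == i then h else if k == i' then h' else f k].
  have [|||C0 Cl bd] := @repl f' (lift 0 i) (lift 0 i').
  + apply: PfE => k rk; rewrite ffunE.
    case: eqP => [E|_]; first by move: ir; rewrite -E; lia.
    by case: eqP => [E|//]; move: i'r; rewrite -E; lia.
  + by rewrite (inj_eq lift_inj).
  + by move=> k; rewrite ffunE !(inj_eq lift_inj) => /negPf -> /negPf ->.
  by move: bd; rewrite !Cl !ffunE !eqxx eq_sym (negPf ne).
Qed.

End Frame.

(** * Counting offsets *)

Lemma card_pairs (I J : finType) (A : {set I * J}) :
  #|A| = (\sum_i \sum_j ((i, j) \in A))%N.
Proof.
rewrite -sum1_card big_mkcond pair_bigA /=; apply: eq_bigr => -[i j] _ /=.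
by case: ifP.
Qed.

Section Octagon.
Variable R : archiRealFieldType.

Lemma card_ord_segment (L s : nat) (t : R) : t <= L%:R ->
  t - s%:R <= #|[set a : 'I_L | (s <= a)%N && (a%:R < t)]|%:R.
Proof.
move=> tL; have [ts|st] := leP t s%:R.
  by apply: le_trans (ler0n _ _); rewrite subr_le0.
have t0 : 0 <= t by apply: le_trans (ltW st); apply: ler0n.
pose T := `|Num.ceil t|%N.
have TE : T%:R = (Num.ceil t)%:~R :> R.
  by rewrite /T natr_absz ger0_norm // -(ler_int R); apply: le_trans t0 (ceil_ge _).
have tT : t <= T%:R by rewrite TE ceil_ge.
have Tt a : (a < T)%N -> a%:R < t.
  move=> aT; rewrite real_ltNge ?num_real //; apply/negP => ta.
  have : (Num.ceil t <= a%:Z) by rewrite ceil_le_int.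
  by rewrite -(ler_int R) -TE ler_nat leqNgt aT.
have TL : (T <= L)%N.
  rewrite leqNgt; apply/negP => /Tt; by rewrite ltNge tL.
have ltL (i : 'I_(T - s)) : (s + i < L)%N by have := ltn_ord i; lia.
pose f i := Ordinal (ltL i).
have injf : injective f by move=> i j /(congr1 val) /= /addnI /val_inj.
apply: (@le_trans _ _ (T - s)%:R).
  by rewrite natrB ?lerD2r // -(ler_nat R); apply: le_trans (ltW st) tT.
rewrite ler_nat -[X in (X <= _)%N](card_ord (T - s)) -(card_imset _ injf).
apply: subset_leq_card; apply/subsetP => a /imsetP[i _ ->].
by rewrite inE leq_addr Tt //=; have := ltn_ord i; lia.
Qed.

Lemma sum_arith (k : nat) (a b : R) :
  \sum_(i < k) (a - b * i.+1%:R) = k%:R * a - b * (k * k.+1)%:R / 2.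
Proof.
elim: k => [|k IHk]; first by rewrite big_ord0 mul0n; ring.
by rewrite big_ord_recr /= IHk !natrM -!natr1; field.
Qed.

(** One eighth of the octagon, strictly on one side of a diagonal; index [a] stands for distance
    [a + 1]. *)
Definition wedge L (ka : R) : {set 'I_L * 'I_L} :=
  [set p : 'I_L * 'I_L | (p.2 < p.1)%N && (p.1.+1%:R + ka * p.2.+1%:R < L%:R)].

(** Only the first [2 l] lines are counted, each bounded below by its length. This cut-off is the
    true extent of the wedge, up to rounding, for [ka = 1/2], the worst case under [mu + nu <= 1],
    and it keeps the bound linear in [ka]. *)
Lemma card_wedge l (ka : R) : 0 <= ka ->
  (2 * l)%:R * ((3 * l)%:R - 1) - (1 + ka) * (l * (2 * l).+1)%:R
    <= #|wedge (3 * l) ka|%:R.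
Proof.
move=> ka0; set L := (3 * l)%N.
pose S (b : nat) : {set 'I_L} := [set a : 'I_L | (b.+1 <= a)%N && (a%:R < L%:R - 1 - ka * b.+1%:R)].
have le2l : (2 * l <= L)%N by rewrite /L; lia.
have -> : #|wedge L ka|%:R = \sum_(b < L) #|S b|%:R :> R.
  rewrite -natr_sum; congr _%:R.
  rewrite card_pairs exchange_big /=; apply: eq_bigr => b _.
  rewrite -sum1_card [RHS]big_mkcond; apply: eq_bigr => a _ /=.
  rewrite !inE /= -[in LHS]natr1 (_ : (_ < L%:R) = (a%:R < L%:R - 1 - ka * b.+1%:R)).
    by case: ifP.
  by rewrite ltrBrDr ltrBrDr addrAC.
have -> : (2 * l)%:R * (L%:R - 1) - (1 + ka) * (l * (2 * l).+1)%:R =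
    \sum_(b < (2 * l)%N) (L%:R - 1 - (1 + ka) * b.+1%:R).
  rewrite sum_arith; congr (_ - _).
  by rewrite -mulnA natrM [X in _ = _ * X / _]natrM; field.
rewrite (big_ord_widen L (fun b => L%:R - 1 - (1 + ka) * b.+1%:R)) //.
rewrite big_mkcond; apply: ler_sum => b _; case: ifP => // _.
apply: le_trans (card_ord_segment b.+1 _).
  by rewrite mulrDl mul1r; lra.
have : 0 <= ka * b.+1%:R by rewrite mulr_ge0 ?ler0n.
lra.
Qed.

(* [2 L] offsets per coordinate, numbered so that offset [i] lies at distance
   at most [dist i] from the origin, on the side given by [i < L]. *)
Definition dist L (i : nat) : nat := if (i < L)%N then (L - i)%N else (i - L).+1.

(** [mu] applies to errors on the same side and [nu] to errors on opposite sides, as the excess over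
    1 of [|c1 + c2|] and of [|c1 - c2|] respectively. *)
Definition octagon L (mu nu : R) : {set 'I_(2 * L) * 'I_(2 * L)} :=
  [set p : 'I_(2 * L) * 'I_(2 * L) |
    let ka := if (p.1 < L)%N == (p.2 < L)%N then mu else nu in
    ((dist L p.1)%:R + ka * (dist L p.2)%:R < L%:R) &&
    (ka * (dist L p.1)%:R + (dist L p.2)%:R < L%:R)].

(** Reflections carry wedges to eight disjoint pieces of the octagon, four for [mu] and four for
    [nu]. The bounds of [card_wedge] are linear, so only [mu + nu <= 1] matters in their sum. *)
Lemma card_octagon l (mu nu : R) : 0 <= mu <= 1 -> 0 <= nu <= 1 -> mu + nu <= 1 ->
  (24 * l ^ 2 - 28 * l <= #|octagon (3 * l) mu nu|)%N.
Proof.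
move=> /andP[mu0 mu1] /andP[nu0 nu1] munu; set L := (3 * l)%N.
pose ka (st : bool * bool) := if st.1 == st.2 then mu else nu.
have ka0 st : 0 <= ka st by rewrite /ka; case: ifP.
have ka1 st : ka st <= 1 by rewrite /ka; case: ifP.
pose X := ((bool * bool) * bool * ('I_L * 'I_L))%type.
pose W := [set x : X | x.2 \in wedge L (ka x.1.1)].
have embP (s : bool) (a : 'I_L) : ((if s then L + a else L.-1 - a) < 2 * L)%N.
  by have := ltn_ord a; case: s; lia.
pose emb s a := Ordinal (embP s a).
have embs s a : (emb s a < L)%N = ~~ s.
  by rewrite /=; have := ltn_ord a; case: s => /=; lia.
have emba s a : dist L (emb s a) = a.+1.
  by rewrite /dist embs; have := ltn_ord a; case: s => /=; lia.
pose f (x : X) := let: (s, t, o, (a, b)) := x in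
  if o then (emb s a, emb t b) else (emb s b, emb t a).
have fW : f @: W \subset octagon L mu nu.
  apply/subsetP => p /imsetP[[[[s t] o] [a b]]]; rewrite !inE /= => /andP[ba lt] ->.
  have le_ab : b.+1%:R <= a.+1%:R :> R by rewrite ler_nat ltnS ltnW.
  have swap : ka (s, t) * a.+1%:R + b.+1%:R < L%:R.
    apply: le_lt_trans lt; rewrite -subr_ge0.
    rewrite (_ : _ - _ = (1 - ka (s, t)) * (a.+1%:R - b.+1%:R)); last by ring.
    by rewrite mulr_ge0 // subr_ge0.
  case: o; rewrite /= !embs !emba (inj_eq negb_inj) -/(ka (s, t)).
    by rewrite lt swap.
  by rewrite [b.+1%:R + _]addrC swap [_ + a.+1%:R]addrC lt.
have injf : {in W &, injective f}.
  move=> [[[s t] o] [a b]] [[[s' t'] o'] [a' b']].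
  rewrite !inE /= => /andP[ba _] /andP[ba' _] eqf.
  have eq1 : (f (s, t, o, (a, b))).1 = (f (s', t', o', (a', b'))).1 by rewrite /f eqf.
  have eq2 : (f (s, t, o, (a, b))).2 = (f (s', t', o', (a', b'))).2 by rewrite /f eqf.
  have es : s = s'.
    by have := congr1 (fun i : 'I__ => (i < L)%N) eq1; rewrite /f; case: (o); case: (o');
       rewrite /fst !embs => /negb_inj.
  have et : t = t'.
    by have := congr1 (fun i : 'I__ => (i < L)%N) eq2; rewrite /f; case: (o); case: (o');
       rewrite /snd !embs => /negb_inj.
  have d1 := congr1 (fun i : 'I__ => dist L i) eq1.
  have d2 := congr1 (fun i : 'I__ => dist L i) eq2.
  move: d1 d2; rewrite /f; case: (o); case: (o');
    rewrite /fst /snd !emba => -[E1] [E2]; rewrite ?es ?et.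
  - by rewrite (val_inj E1) (val_inj E2).
  - by move: ba ba'; rewrite E1 E2; lia.
  - by move: ba ba'; rewrite E1 E2; lia.
  - by rewrite (val_inj E1) (val_inj E2).
have := subset_leq_card fW; rewrite (card_in_imset injf); apply: leq_trans.
have -> : #|W| = (4 * (#|wedge L mu| + #|wedge L nu|))%N.
  rewrite card_pairs.
  transitivity (\sum_(sto : bool * bool * bool) #|wedge L (ka sto.1)|)%N.
    apply: eq_bigr => sto _; rewrite card_pairs !pair_bigA /=.
    by apply: eq_bigr => -[a b] _; rewrite !inE.
  rewrite -(pair_bigA _ (fun st (o : bool) => #|wedge L (ka st)|)) /=.
  rewrite -(pair_bigA _ (fun s t => \sum_(o : bool) #|wedge L (ka (s, t))|)%N) /=.
  by rewrite !big_bool /ka /=; lia.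
have := card_wedge l mu0; have := card_wedge l nu0; rewrite -/L => cnu cmu.
rewrite leq_subLR -(ler_nat R) !(natrD, natrM).
have LE : L%:R = 3 * l%:R :> R by rewrite natrM.
have E2 : (2 * l).+1%:R = 2 * l%:R + 1 :> R by rewrite -natr1 natrM.
move: cnu cmu; rewrite LE !natrM E2.
move: (#|wedge L mu|%:R) (#|wedge L nu|%:R) => wm wn cn cm.
have l0 : 0 <= l%:R :> R by apply: ler0n.
have : 0 <= (1 - mu - nu) * (l%:R * (2 * l%:R + 1)).
  by rewrite !mulr_ge0 //; lra.
nra.
Qed.

End Octagon.

(** * Parts of dimension two and three *)

(** If [x2 <= x1], write the form as [c1 (x1 - x2) + (c1 + c2) x2], which is at most [x1 + ka x2] in
    absolute value; the other case is symmetric. *)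
Lemma octagon_form (R : realFieldType) (c1 c2 ka x1 x2 a b L : R) :
  `|c1| <= 1 -> `|c2| <= 1 -> `|c1 + c2| <= 1 + ka -> 0 <= ka ->
  0 <= x1 <= a -> 0 <= x2 <= b ->
  a + ka * b < L -> ka * a + b < L -> `|c1 * x1 + c2 * x2| < L.
Proof.
move=> c1le c2le cle ka0 /andP[x10 x1a] /andP[x20 x2b] lt1 lt2.
have kx1 : ka * x1 <= ka * a by apply: ler_wpM2l.
have kx2 : ka * x2 <= ka * b by apply: ler_wpM2l.
have [le21|lt12] := leP x2 x1.
  rewrite (_ : _ + _ = c1 * (x1 - x2) + (c1 + c2) * x2); last by ring.
  apply: le_lt_trans (ler_normD _ _) _; rewrite !normrM.
  have -> : `|x1 - x2| = x1 - x2 by rewrite ger0_norm // subr_ge0.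
  rewrite (ger0_norm x20).
  have : `|c1| * (x1 - x2) <= 1 * (x1 - x2) by apply: ler_wpM2r; rewrite ?subr_ge0.
  have : `|c1 + c2| * x2 <= (1 + ka) * x2 by apply: ler_wpM2r.
  lra.
rewrite (_ : _ + _ = c2 * (x2 - x1) + (c1 + c2) * x1); last by ring.
apply: le_lt_trans (ler_normD _ _) _; rewrite !normrM.
have -> : `|x2 - x1| = x2 - x1 by rewrite ger0_norm // subr_ge0 ltW.
rewrite (ger0_norm x10).
have : `|c2| * (x2 - x1) <= 1 * (x2 - x1) by apply: ler_wpM2r; rewrite // subr_ge0 ltW.
have : `|c1 + c2| * x1 <= (1 + ka) * x1 by apply: ler_wpM2r.
lra.
Qed.

Lemma octagon_form_signed (R : realFieldType) (c1 c2 mu nu z1 z2 a b L : R) (s t : bool) :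
  `|c1| <= 1 -> `|c2| <= 1 -> `|c1 + c2| <= 1 + mu -> `|c1 - c2| <= 1 + nu ->
  0 <= mu -> 0 <= nu ->
  (if s then - a <= z1 <= 0 else 0 <= z1 <= a) ->
  (if t then - b <= z2 <= 0 else 0 <= z2 <= b) ->
  let ka := if s == t then mu else nu in
  a + ka * b < L -> ka * a + b < L -> `|c1 * z1 + c2 * z2| < L.
Proof.
move=> c1le c2le cmu cnu mu0 nu0 z1P z2P ka.
have neg (x y : R) : - y <= x <= 0 -> 0 <= - x <= y.
  by move=> /andP[? ?]; apply/andP; split; lra.
case: s z1P @ka => z1P; case: t z2P => z2P /= lt1 lt2.
- rewrite -normrN (_ : - _ = c1 * - z1 + c2 * - z2); last by ring.
  exact: octagon_form cmu mu0 (neg _ _ z1P) (neg _ _ z2P) lt1 lt2.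
- rewrite -normrN (_ : - _ = c1 * - z1 + - c2 * z2); last by ring.
  by apply: octagon_form cnu nu0 (neg _ _ z1P) z2P lt1 lt2; rewrite ?normrN.
- rewrite (_ : _ + _ = c1 * z1 + - c2 * - z2); last by ring.
  by apply: octagon_form cnu nu0 z1P (neg _ _ z2P) lt1 lt2; rewrite ?normrN.
- exact: octagon_form cmu mu0 z1P z2P lt1 lt2.
Qed.

(** After sign changes, add the products [(1 - y) (1 - x') >= 0] and [(1 - x) (1 - y') >= 0] to the
    bound on the 2x2 minor. *)
Lemma octagon_params (R : realFieldType) (a b a' b' mu nu : R) :
  `|a| <= 1 -> `|b| <= 1 -> `|a'| <= 1 -> `|b'| <= 1 -> `|a * b' - b * a'| <= 1 ->
  `|a + b| = 1 + mu -> `|a' - b'| = 1 + nu -> 0 <= mu -> 0 <= nu -> mu + nu <= 1.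
Proof.
have core (x y x' y' : R) : x <= 1 -> y <= 1 -> x' <= 1 -> y' <= 1 -> x * y' + y * x' <= 1 ->
    (x + y - 1) + (x' + y' - 1) <= 1.
  move=> x1 y1 x1' y1' det1.
  have : 0 <= (1 - y) * (1 - x') by rewrite mulr_ge0 ?subr_ge0.
  have : 0 <= (1 - x) * (1 - y') by rewrite mulr_ge0 ?subr_ge0.
  by nra.
rewrite !ler_norml => /andP[? ?] /andP[? ?] /andP[? ?] /andP[? ?] /andP[? ?].
case: (ger0P (a + b)) => s1; case: (ger0P (a' - b')) => s2 E1 E2 mu0 nu0.
- by have := @core a b a' (- b'); lra.
- by have := @core a b (- a') b'; lra.
- by have := @core (- a) (- b) a' (- b'); lra.
- by have := @core (- a) (- b) (- a') b'; lra.
Qed.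

Lemma max_excess (R : realFieldType) m (F : 'I_m -> R) :
  exists2 mu, 0 <= mu /\ (forall h, F h <= 1 + mu) &
    mu = 0 \/ exists h, F h = 1 + mu.
Proof.
have [h0 lt0|no] := pickP (fun h => 1 < F h); last first.
  exists 0; last by left.
  by split=> // h; rewrite addr0 leNgt no.
pose h1 := [arg max_(h > h0) F h]%O.
have h1P h : F h <= F h1 by rewrite /h1; case: arg_maxP => // k _; apply.
exists (F h1 - 1); last by right; exists h1; ring.
split=> [|h]; last by rewrite addrC subrK.
by rewrite subr_ge0; apply: le_trans (ltW lt0) (h1P h0).
Qed.

(** [h] counts the values of [k], [c] the offset pairs for each, and the left side of the conclusion
    the classes. The octagon fills about 2/3 of the square of side [6 l], whence the factor 3/2.
    With [l = 3 h], the integral gap [3 D <= 2 h - 1] gains [108 h^2], more than the boundary loss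
    [84 h^2]. *)
Lemma pigeon_count h l c D : (l = 3 * h -> 0 < h -> 3 * D < 2 * h ->
  24 * l ^ 2 - 28 * l <= c -> 2 * (3 * l) * (2 * (3 * l)) * D < h * c)%N.
Proof.
move=> lE h0 ltD cle.
have hh : (0 < h * h)%N by rewrite muln_gt0 h0.
have {}cle : (216 * (h * h) <= c + 84 * h)%N by move: cle; rewrite lE -mulnn; lia.
have := leq_mul (leqnn (h * h)) ltD; have := leq_mul (leqnn h) cle; rewrite lE; lia.
Qed.

Lemma absz_modz_ltn (N : nat) (z : int) : (0 < N)%N -> (`|(z %% N)%Z| < N)%N.
Proof. by move=> N0; have := @ltz_mod z N; have := @modz_ge0 z N; lia. Qed.

Lemma absz_modz_inj (N : nat) (z z' : int) : (0 < N)%N ->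
  `|(z %% N)%Z|%N = `|(z' %% N)%Z|%N -> z - z' = ((z %/ N)%Z - (z' %/ N)%Z) * N%:Z.
Proof.
move=> N0 E; have {}E : (z %% N)%Z = (z' %% N)%Z.
  by have := @modz_ge0 z N; have := @modz_ge0 z' N; lia.
by rewrite {1}(divz_eq z N) {1}(divz_eq z' N) E; ring.
Qed.

Section Pieces.
Variables (R : archiRealFieldType) (m n : nat).
Variables (A : 'M[int]_(m, n.+1)) (al : 'rV[int]_n.+1) (D0 : nat).
Let M : 'M[R]_(n.+1, m) := rmat R A.
Hypothesis pointed : kerS M setT = 0.
Hypothesis det_le : forall f : 'I_n -> 'I_m, (`|\det (basis A al f)| <= D0)%N.

Definition intv (u : 'rV[int]_n.+1) : 'rV[R]_n.+1 := map_mx intr u.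

Lemma int_coords (f : 'I_n -> 'I_m) u (X : 'rV[int]_n.+1) :
  u *m (basis A al f)^T = X ->
  ralpha al (intv u) = (X 0 0)%:~R /\
  forall i, ev M (intv u) (f i) = (X 0 (lift 0 i))%:~R.
Proof.
move=> uX; have E : intv u *m (map_mx intr (basis A al f))^T = map_mx intr X.
  by rewrite -uX /intv map_trmx -map_mxM.
split=> [|i]; first by rewrite -(basis0 A al f) E mxE.
by rewrite -(basis_lift A al f) E mxE.
Qed.

(** Prescribed values on a frame: [k] for [al] and [p i] for its [i]-th row. *)
Definition frame_vec (k : int) (p : 'I_n -> int) : 'rV[int]_n.+1 :=
  \row_j oapp p k (unlift 0 j).

Variable q : 'rV[R]_n.+1.
Hypothesis alq : 0 < ralpha al q.
Hypothesis latfree : forall (u : 'rV[int]_n.+1) (tau : R), 0 <= tau <= 1 ->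
  (forall h, `|ev M (intv u) h - tau * ev M q h| < 1) -> u = 0.

(** For [tau = k / al q] the vector [u - tau q] lies in [al = 0] and vanishes on the frame rows from
    [r] on, so the frame expands every row on it in the first [r]. *)
Lemma latfree_frame (f : 'I_n -> 'I_m) (c : 'I_m -> 'I_n -> R) r u (k : R) :
  (forall i : 'I_n, (r <= i)%N -> f i \in zset M q) ->
  (forall h e, ralpha al e = 0 ->
     (forall i : 'I_n, (r <= i)%N -> ev M e (f i) = 0) ->
     ev M e h = \sum_(i < n | (i < r)%N) c h i * ev M e (f i)) ->
  0 <= k <= ralpha al q -> ralpha al (intv u) = k ->
  (forall i : 'I_n, (r <= i)%N -> ev M (intv u) (f i) = 0) ->
  (forall h, `|\sum_(i < n | (i < r)%N)
     c h i * (ev M (intv u) (f i) - k * (ev M q (f i) / ralpha al q))| < 1) ->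
  u = 0.
Proof.
move=> fZ cE /andP[k0 kq] auk uf bd.
apply: (@latfree u (k / ralpha al q)).
  by rewrite divr_ge0 ?(ltW alq) //= ler_pdivrMr // mul1r.
move=> h; have := bd h; rewrite -evZ -evB cE.
- congr (`|_| < _); apply: eq_bigr => i _; congr (_ * _).
  by rewrite evB evZ; congr (_ - _); ring.
- by rewrite ralphaB ralphaZ auk divfK ?gt_eqF // subrr.
- move=> i ri; rewrite evB evZ uf // sub0r.
  by have := fZ i ri; rewrite inE => /eqP ->; rewrite mulr0 oppr0.
Qed.

Lemma frame_vec_sub k p k' p' i :
  (frame_vec k p - frame_vec k' p') 0 (lift 0 i) = p i - p' i.
Proof. by rewrite !mxE liftK. Qed.
Lemma frame_vec_sub0 k p k' p' : (frame_vec k p - frame_vec k' p') 0 0 = k - k'.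
Proof. by rewrite !mxE unlift_none. Qed.

(** For [0 <= k <= H] round the point with coordinates [k], [k x], 0, ... down. If there are more
    such points than classes, two of them differ by a lattice vector [u] whose only error is a
    difference of two fractional parts, so below 1 on every row; then [u = 0], although the values
    of [k] differ. *)
Lemma piece2 : (0 < n)%N -> (\rank (kerS M (zset M q)) <= 2)%N ->
  ralpha al q < D0%:R.
Proof.
move=> n0 rkq.
have [f [c [detf fZ cE c1 _]]] := frame pointed n0 rkq (sub_kerS_zset (subxx _)) (lt0r_neq0 alq).
have [|F [cls [cardF clsP]]] := @lattice_classes _ (basis A al f)^T.
  by rewrite det_tr.
pose i0 := Ordinal n0; pose x := ev M q (f i0) / ralpha al q.
pose H := Num.trunc (ralpha al q).
have /andP[Hle ltH] := truncn_itv (ltW alq); rewrite -/H in Hle ltH.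
pose p (k : 'I_H.+1) (i : 'I_n) : int :=
  if i == i0 then Num.floor (k%:R * x) else 0.
pose V (k : 'I_H.+1) := frame_vec k%:Z (p k).
apply: lt_le_trans ltH _; rewrite ler_nat.
apply: leq_trans (det_le f); rewrite -det_tr -cardF leqNgt; apply/negP => lt.
have : ~~ injectiveb (fun k => cls (V k)).
  by apply: contraL lt => /injectiveP /leq_card; rewrite card_ord -leqNgt.
move=> /injectivePn[k [k' nek eqk]].
wlog lekk' : k k' nek eqk / (k' < k)%N => [wl|].
  case: (ltngtP k k') => [lt1|lt1|E]; [|exact: (wl k k')|].
  - by apply: (wl k' k) => //; rewrite eq_sym.
  - by move: nek; rewrite (val_inj E) eqxx.
have [u uE] := clsP _ _ eqk.
have [au uf] := int_coords (esym uE).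
have Vf i : (V k - V k') 0 (lift 0 i) = p k i - p k' i := frame_vec_sub _ _ _ _ _.
have V0 : (V k - V k') 0 0 = (k%:Z - k'%:Z) := frame_vec_sub0 _ _ _ _.
have kk' : (k%:Z - k'%:Z)%:~R = k%:R - k'%:R :> R by rewrite rmorphB.
have u0 : u = 0.
  apply: (latfree_frame fZ cE (k := k%:R - k'%:R)).
  - rewrite subr_ge0 ler_nat ltnW //=; apply: le_trans Hle.
    by rewrite -natrB ?ler_nat ?(ltnW lekk') //; have := ltn_ord k; lia.
  - by rewrite au V0 kk'.
  - move=> i i1; rewrite uf Vf /p (_ : (i == i0) = false) ?subrr //.
    by apply/negbTE; apply: contraTneq i1 => ->.
  - move=> h; rewrite (big_pred1 i0) => [|i]; last first.
      by rewrite /= -val_eqE /=; case: (nat_of_ord i).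
    rewrite normrM; apply: le_lt_trans (_ : 1 * _ < 1).
      by apply: ler_wpM2r; rewrite ?c1.
    rewrite mul1r uf Vf /p eqxx rmorphB /= -/x.
    have /andP[] := floor_itv (k%:R * x); have /andP[] := floor_itv (k'%:R * x).
    rewrite !rmorphD /= ltr_norml; lra.
by move: V0; rewrite uE u0 mul0mx mxE; lia.
Qed.

(* For each [k <= al q], the vector with coordinates [k], [k x i0], [k x i1], 0, ...
   has two coordinates that need not be integral.  We round them to multiples of [1 / N]
   in all ways whose two errors, in units of [1 / N], lie in the octagon, where
   every row is bounded by [L = N / 2].  Two roundings that agree modulo 1 and
   whose integral parts agree modulo the lattice give a lattice vector on which
   every row is off by less than [2 L / N = 1]. *)
Lemma piece3 : (1 < n)%N -> (\rank (kerS M (zset M q)) <= 3)%N ->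
  ralpha al q < 3 / 2 * D0%:R.
Proof.
move=> n1 rkq.
have [f [c [detf fZ cE c1 c2]]] := frame pointed n1 rkq (sub_kerS_zset (subxx _)) (lt0r_neq0 alq).
have [|F [cls [cardF clsP]]] := @lattice_classes _ (basis A al f)^T.
  by rewrite det_tr.
pose i0 : 'I_n := Ordinal (ltnW n1); pose i1 : 'I_n := Ordinal n1.
have [mu [mu0 muP] muE] := max_excess (fun h => `|c h i0 + c h i1|).
have [nu [nu0 nuP] nuE] := max_excess (fun h => `|c h i0 - c h i1|).
have le1 h : `|c h i0 + c h i1| <= 2 /\ `|c h i0 - c h i1| <= 2.
  have := c1 h i0 isT; have := c1 h i1 isT.
  by rewrite !ler_norml => /andP[? ?] /andP[? ?]; split; apply/andP; split; lra.
have mu1 : mu <= 1 by case: muE => [->|[h E]]; [exact: ler01 | have [] := le1 h; lra].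
have nu1 : nu <= 1 by case: nuE => [->|[h E]]; [exact: ler01 | have [] := le1 h; lra].
have munu : mu + nu <= 1.
  case: muE => [->|[h Eh]]; first by rewrite add0r.
  case: nuE => [->|[h' Eh']]; first by rewrite addr0.
  by apply: octagon_params Eh Eh' mu0 nu0; rewrite ?c1 ?c2.
pose x i := ev M q (f i) / ralpha al q.
pose H := Num.trunc (ralpha al q).
have /andP[Hle ltH] := truncn_itv (ltW alq); rewrite -/H in Hle ltH.
pose D := `|\det (basis A al f)|%N.
rewrite ltNge; apply/negP => large.
have ltD : (3 * D < 2 * H.+1)%N.
  rewrite -(ltr_nat R) !natrM.
  have : D%:R <= D0%:R :> R by rewrite ler_nat; apply: det_le.
  lra.
pose l := (3 * H.+1)%N; pose L := (3 * l)%N; pose N := (2 * L)%N.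
have N0 : (0 < N)%N by [].
have NR : 0 < N%:R :> R by rewrite ltr0n.
pose T := ('I_H.+1 * ('I_N * 'I_N))%type.
pose Om := [set w : T | w.2 \in octagon L mu nu].
(* Offset [L - 1] rounds down and offset [L] rounds up, which puts each error on the side and within
   the distance recorded by [dist]. *)
pose ofs (k : 'I_H.+1) (i : 'I_n) (j : 'I_N) : int :=
  Num.floor (N%:R * (k%:R * x i)) + 1 - L%:Z + j%:Z.
pose err k i j : R := (ofs k i j)%:~R - N%:R * (k%:R * x i).
pose p (w : T) (i : 'I_n) : int :=
  if i == i0 then (ofs w.1 i0 w.2.1 %/ N)%Z
  else if i == i1 then (ofs w.1 i1 w.2.2 %/ N)%Z else 0.
pose V (w : T) := frame_vec w.1%:Z (p w).
pose res (z : int) : 'I_N := Ordinal (absz_modz_ltn z N0).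
have resE z z' : res z = res z' -> z - z' = ((z %/ N)%Z - (z' %/ N)%Z) * N%:Z.
  by move=> /(congr1 val); apply: absz_modz_inj.
pose cl (w : T) := (res (ofs w.1 i0 w.2.1), res (ofs w.1 i1 w.2.2), cls (V w)).
have errP k i (j : 'I_N) : if (j < L)%N then - (dist L j)%:R <= err k i j <= 0
    else 0 <= err k i j <= (dist L j)%:R.
  rewrite /err /ofs !rmorphD /= rmorphN /=.
  have /andP[] := floor_itv (N%:R * (k%:R * x i)); rewrite rmorphD /=.
  move: (Num.floor _)%:~R => fl lo hi.
  have jE : j%:Z%:~R = j%:R :> R by []. have LE : L%:Z%:~R = L%:R :> R by [].
  rewrite jE LE /dist; case: ltnP => jL.
    have : j.+1%:R <= L%:R :> R by rewrite ler_nat.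
    by rewrite natrB ?(ltnW jL) // -natr1 => ?; apply/andP; split; lra.
  have : L%:R <= j%:R :> R by rewrite ler_nat.
  by rewrite -natr1 natrB // => ?; apply/andP; split; lra.
have bound h k j : j \in octagon L mu nu ->
    `|c h i0 * err k i0 j.1 + c h i1 * err k i1 j.2| < L%:R.
  rewrite inE => /andP[lt1 lt2].
  by apply: (octagon_form_signed (c1 _ _ _) (c1 _ _ _) (muP h) (nuP h) mu0 nu0
    (errP k i0 j.1) (errP k i1 j.2) lt1 lt2).
have [w [w' [wOm w'Om nww' clw]]] : exists w w', [/\ w \in Om, w' \in Om, w != w' & cl w = cl w'].
  have : ~~ dinjectiveb cl (mem Om).
    apply/negP => /dinjectiveP /card_in_imset cardE.
    have := max_card (mem (cl @: Om)); rewrite cardE !card_prod !card_ord cardF det_tr -/D.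
    have -> : #|Om| = (H.+1 * #|octagon L mu nu|)%N.
      rewrite card_pairs.
      transitivity (\sum_(k < H.+1) #|octagon L mu nu|)%N.
        apply: eq_bigr => k _; rewrite -sum1_card [RHS]big_mkcond /=.
        by apply: eq_bigr => j _; rewrite !inE; case: ifP.
      by rewrite sum_nat_const card_ord.
    have := @card_octagon R l mu nu; rewrite mu0 mu1 nu0 nu1 => /(_ isT isT munu).
    rewrite -/L; move: #|_| => Oct le1' le2'.
    by have := pigeon_count (erefl l) (ltn0Sn H) ltD le1'; rewrite -/L -/N ltnNge le2'.
  case/dinjectivePn => w wOm [w']; rewrite inE => /andP[ne w'Om] E.
  by exists w, w'; split => //; rewrite eq_sym.
wlog lekk' : w w' wOm w'Om nww' clw / (w'.1 <= w.1)%N => [wl|].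
  case: (leqP w'.1 w.1) => [|/ltnW]; first exact: wl.
  by apply: wl => //; rewrite eq_sym.
have [/resE res0 /resE res1 /clsP[u uE]] :
    [/\ res (ofs w.1 i0 w.2.1) = res (ofs w'.1 i0 w'.2.1),
        res (ofs w.1 i1 w.2.2) = res (ofs w'.1 i1 w'.2.2) & cls (V w) = cls (V w')].
  split; [exact: (congr1 (fun t => t.1.1) clw) | exact: (congr1 (fun t => t.1.2) clw) |].
  exact: (congr1 snd clw).
have [au uf] := int_coords (esym uE).
have Vf i : (V w - V w') 0 (lift 0 i) = p w i - p w' i := frame_vec_sub _ _ _ _ _.
have V0 : (V w - V w') 0 0 = (w.1%:Z - w'.1%:Z) := frame_vec_sub0 _ _ _ _.
(* Equal residues make the division by [N] exact on differences, so [N] times the error of [u] is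
   the difference of two rounding errors. *)
have X0 : N%:R * ((p w i0 - p w' i0)%:~R - (w.1%:R - w'.1%:R) * x i0) =
    err w.1 i0 w.2.1 - err w'.1 i0 w'.2.1 :> R.
  rewrite /p eqxx /err mulrBr -[N%:R * _%:~R]mulrC -[N%:R]/(N%:Z%:~R) -rmorphM /=.
  by rewrite -res0 rmorphB /=; ring.
have X1 : N%:R * ((p w i1 - p w' i1)%:~R - (w.1%:R - w'.1%:R) * x i1) =
    err w.1 i1 w.2.2 - err w'.1 i1 w'.2.2 :> R.
  rewrite /p eqxx (_ : (i1 == i0) = false) // /err mulrBr.
  rewrite -[N%:R * _%:~R]mulrC -[N%:R]/(N%:Z%:~R) -rmorphM /=.
  by rewrite -res1 rmorphB /=; ring.
have u0 : u = 0.
  apply: (latfree_frame fZ cE (k := w.1%:R - w'.1%:R)).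
  - rewrite subr_ge0 ler_nat lekk' /=; apply: le_trans Hle.
    by rewrite -natrB // ler_nat; apply: leq_trans (leq_subr _ _) (leq_ord _).
  - by rewrite au V0 rmorphB.
  - move=> i i2; rewrite uf Vf /p (_ : (i == i0) = false); last first.
      by apply/negbTE; apply: contraTneq i2 => ->.
    by rewrite (_ : (i == i1) = false) ?subrr //; apply/negbTE; apply: contraTneq i2 => ->.
  - move=> h; rewrite (bigD1 i0) //= (bigD1 i1) //= big1 ?addr0 => [|i]; last first.
      by rewrite -!val_eqE /=; case: (nat_of_ord i) => [|[]].
    rewrite !uf !Vf -/(x i0) -/(x i1).
    rewrite -(ltr_pM2l NR) mulr1 -[X in X * `|_|](gtr0_norm NR) -normrM mulrDr.
    rewrite !(mulrCA N%:R) X0 X1.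
    have := bound h w.1 w.2; have := bound h w'.1 w'.2.
    move: wOm w'Om; rewrite !inE /= => wOm w'Om.
    move=> /(_ w'Om) b' /(_ wOm) b.
    have NE : N%:R = L%:R + L%:R :> R by rewrite -natrD addnn -mul2n.
    rewrite NE; apply: le_lt_trans (ltrD b b'); apply: le_trans (ler_normB _ _).
    by rewrite le_eqVlt; apply/orP; left; apply/eqP; congr `|_|; ring.
(* From [u = 0] the values of [k] and the integral parts agree; the residues agree already, so [w]
   and [w'] are the same choice. *)
have VV i : (V w - V w') 0 i = 0 by rewrite uE u0 mul0mx mxE.
have k_eq : w.1 = w'.1 by apply/val_inj; move: (VV 0); rewrite V0 => /subr0_eq [].
have p0 : p w i0 = p w' i0 by apply/subr0_eq; rewrite -Vf VV.
have p1 : p w i1 = p w' i1 by apply/subr0_eq; rewrite -Vf VV.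
have j0 : w.2.1 = w'.2.1.
  apply/val_inj; move: res0 p0; rewrite /p eqxx => E E'.
  by move: E; rewrite E' subrr mul0r /ofs k_eq => /subr0_eq /addrI [].
have j1 : w.2.2 = w'.2.2.
  apply/val_inj; move: res1 p1; rewrite /p eqxx (_ : (i1 == i0) = false) // => E E'.
  by move: E; rewrite E' subrr mul0r /ofs k_eq => /subr0_eq /addrI [].
case/eqP: nww'; move: k_eq j0 j1.
by case: (w) => [? [? ?]]; case: (w') => [? [? ?]] /= -> -> ->.
Qed.

End Pieces.

(** * The distance bound *)

Section Width.
Variables (R : archiRealFieldType) (m n : nat).
Variables (A : 'M[int]_(m, n.+1)) (al : 'rV[int]_n.+1) (D0 : nat).
Let M : 'M[R]_(n.+1, m) := rmat R A.
Hypothesis pointed : kerS M setT = 0.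
Hypothesis n_gt0 : (0 < n)%N.
Hypothesis D_gt0 : (0 < D0)%N.
Hypothesis det_le : forall f : 'I_n -> 'I_m, (`|\det (basis A al f)| <= D0)%N.
Variable w : 'rV[R]_n.+1.
Hypothesis latfree : forall q, frac M setT q w ->
  forall (u : 'rV[int]_n.+1) (tau : R), 0 <= tau <= 1 ->
  (forall h, `|ev M (intv R u) h - tau * ev M q h| < 1) -> u = 0.

(** The induction runs on an upper bound [k >= 2] of the dimension. Peeling happens only in
    dimension at least 4, so [k - 2 >= 2] still bounds the remainder, however small that is. *)
Lemma width_lt k x : (2 <= k)%N -> (\rank (kerS M (zset M x)) <= k)%N ->
  frac M setT x w -> ralpha al x < k%:R / 2 * D0%:R.
Proof.
have D0R : 0 < D0%:R :> R by rewrite ltr0n.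
have small y : (\rank (kerS M (zset M y)) <= 2)%N -> frac M setT y w ->
    ralpha al y < D0%:R.
  move=> rky fry; have [ay|ay] := leP (ralpha al y) 0; first exact: le_lt_trans ay D0R.
  by apply: (piece2 pointed det_le ay) => //; apply: latfree.
elim/ltn_ind: k x => k IHk x k2 rkx frx.
have kR : 2 <= k%:R :> R by rewrite ler_nat.
have [rk2|rk2] := leqP (\rank (kerS M (zset M x))) 2.
  apply: lt_le_trans (small x rk2 frx) _.
  by rewrite ler_peMl ?(ltW D0R) //; lra.
have [rk3|rk3] := leqP (\rank (kerS M (zset M x))) 3.
  have k3 : 3 <= k%:R :> R by rewrite ler_nat (leq_trans rk2).
  apply: (@lt_le_trans _ _ (3 / 2 * D0%:R)); last by rewrite ler_wpM2r ?(ltW D0R) //; lra.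
  have [ax|ax] := leP (ralpha al x) 0.
    by apply: le_lt_trans ax _; rewrite mulr_gt0 //; lra.
  apply: (piece3 pointed det_le ax) => //; first exact: latfree.
  by have := rank_leq_row (kerS M (zset M x)); lia.
have [q [frq rkq rkxq]] := peel pointed rk2.
have := small q rkq (frac_trans frq frx).
have := IHk (k - 2)%N _ (x - q) _ _ (frac_trans (frac_subl frq) frx).
rewrite ralphaB natrB // => IH.
have /IH : (k - 2 < k)%N by lia.
have k4 : (2 <= k - 2)%N by lia.
by move=> /(_ k4) => H; have := H (leq_trans rkxq (leq_sub2r 2 rkx)); lra.
Qed.

End Width.

(** * Choice of the integer optimum *)

Lemma int_argmax (T : Type) (S : T -> Prop) (F : T -> int) (B : int) :
  (exists x, S x) -> (forall x, S x -> F x <= B) ->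
  exists2 x, S x & forall y, S y -> F y <= F x.
Proof.
move=> [x0 Sx0] FB; pose P (k : nat) := `[< exists2 x, S x & F x = B - k%:Z >].
have val x : S x -> P `|B - F x|%N.
  by move=> Sx; apply/asboolP; exists x => //; have := FB x Sx; lia.
have [k /asboolP[x Sx Fx] kmin] := ex_minnP (ex_intro P _ (val x0 Sx0)).
by exists x => // y Sy; have := kmin _ (val y Sy); have := FB y Sy; lia.
Qed.

Lemma clear_denominators n (c : 'cV[rat]_n) :
  exists2 d : int, 0 < d & exists C : 'cV[int]_n, map_mx intr C = d%:~R *: c.
Proof.
exists (\prod_j denq (c j 0)); first by apply: prodr_gt0 => j _; apply: denq_gt0.
exists (\col_j (numq (c j 0) * \prod_(i | i != j) denq (c i 0))).
apply/colP => j; rewrite !mxE [in RHS](bigD1 j) //= !rmorphM /= -{3}[c j 0]divq_num_den.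
by field; rewrite intr_eq0 denq_neq0.
Qed.

Section LatticePoint.
Variables (R : archiRealFieldType) (m n : nat) (A : 'M[int]_(m, n)).
Variables (b : 'I_m -> int) (g : 'cV[R]_n) (d : int) (C : 'cV[int]_n).
Let M : 'M[R]_(n, m) := (map_mx intr A)^T.
Let P (x : 'rV[R]_n) := forall i, ev M x i <= (b i)%:~R.
Let cost (x : 'rV[R]_n) := (x *m g) 0 0.
Let intv (u : 'rV[int]_n) : 'rV[R]_n := map_mx intr u.
Hypotheses (d_gt0 : 0 < d) (dg : d%:~R *: g = map_mx intr C).
Variable xs : 'rV[R]_n.
Hypothesis Pxs : P xs.
Hypothesis xs_extreme : forall e, P (xs + e) -> P (xs - e) -> e = 0.
Hypothesis xs_optimal : forall y, P y -> cost y <= cost xs.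

Lemma ev_intv u i : ev M (intv u) i = ((u *m A^T) 0 i)%:~R.
Proof. by rewrite /ev /M map_trmx -map_mxM mxE. Qed.

Lemma slack_step e : exists2 eps, 0 < eps &
  forall i, ev M xs i != (b i)%:~R -> eps * `|ev M e i| <= (b i)%:~R - ev M xs i.
Proof.
pose s i := (b i)%:~R - ev M xs i; have s0 i : 0 <= s i by rewrite subr_ge0.
pose r i := `|ev M e i| / s i; have r0 i : 0 <= r i by rewrite divr_ge0.
have K0 : 0 < 1 + \sum_i r i by apply: ltr_wpDr; rewrite ?sumr_ge0.
(* One step length for all rows that are not tight: its inverse exceeds every ratio [r i], and the
   summand 1 keeps it defined when all of them vanish. *)
exists (1 + \sum_i r i)^-1; first by rewrite invr_gt0.
move=> i xi; have si : 0 < s i by rewrite lt_def s0 subr_eq0 eq_sym xi.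
rewrite mulrC ler_pdivrMr // mulrC -ler_pdivrMr // -/(r i).
by rewrite (bigD1 i) //= addrCA lerDl addr_ge0 // sumr_ge0.
Qed.

Lemma lattice_point_exists : (exists z, P (intv z)) ->
  exists z, [/\ P (intv z), forall y, P (intv y) -> cost (intv y) <= cost (intv z) &
    forall q u tau, frac M setT q (intv z - xs) -> 0 <= tau <= 1 ->
      (forall h, `|ev M (intv u) h - tau * ev M q h| < 1) -> u = 0].
Proof.
move=> feas; have dR : 0 < d%:~R :> R by rewrite ltr0z.
have costE u : d%:~R * cost (intv u) = ((u *m C) 0 0)%:~R.
  by rewrite /cost -mx11Z scalemxAr dg -map_mxM mxE.
(* Scaled by [d], costs of integer points are integers bounded by the cost of [xs], so a maximum is
   attained. *)
have [z1 Pz1 max1] : exists2 z, P (intv z) &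
    forall y, P (intv y) -> (y *m C) 0 0 <= (z *m C) 0 0.
  apply: int_argmax feas (_ : forall x, _ -> _ <= Num.floor (d%:~R * cost xs)) => x Px.
  by rewrite floor_ge_int -costE ler_pM2l // xs_optimal.
pose tight i := ev M xs i == (b i)%:~R.
pose S z := P (intv z) /\ (z *m C) 0 0 = (z1 *m C) 0 0.
pose F (z : 'rV[int]_n) := \sum_(i | tight i) (z *m A^T) 0 i.
have [||z [Pz zC] max2] := @int_argmax _ S F (\sum_(i | tight i) b i).
- by exists z1.
- by move=> x [Px _]; apply: ler_sum => i _; rewrite -(ler_int R) -ev_intv.
exists z; split=> // [y Py|q u tau frq /andP[t0 t1] bd].
  by rewrite -(ler_pM2l dR) !costE ler_int zC max1.
pose U i := (u *m A^T) 0 i; pose w := intv z - xs.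
(* Row by row, [tau] times a part of [w] is a fraction [s] of [w], with [s] depending on the row. *)
have near i : exists2 s, 0 <= s <= 1 & `|(U i)%:~R - s * ev M w i| < 1.
  have [r /andP[r0 r1] E] := frq i (in_setT i); exists (tau * r).
    by rewrite mulr_ge0 //= mulr_ile1.
  by rewrite -mulrA -E -ev_intv.
have intvB y y' : intv (y - y') = intv y - intv y' by apply: map_mxB.
(* The row value at [z - u] is less than 1 above a convex combination of those at [z] and [xs],
   hence below [b i + 1]; being an integer, it is at most [b i]. *)
have Pzu : P (intv (z - u)).
  move=> i; rewrite ev_intv ler_int mulmxBl mxE [X in _ + X]mxE -ltzD1 -(ltr_int R).
  rewrite rmorphB rmorphD /= -ev_intv -/(U i).
  have [s /andP[s0 s1]] := near i; rewrite ltr_norml evB => /andP[lt _].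
  have := ler_wpM2l s0 (Pxs i); have : 0 <= 1 - s by lra.
  by move=> /ler_wpM2l /(_ _ _ (Pz i)); lra.
have Utight i : tight i -> U i <= 0.
  move=> /eqP ti; rewrite -ltzD1 add0r -(ltr_int R).
  have [s /andP[s0 s1]] := near i; rewrite ltr_norml evB ti => /andP[_].
  have : ev M (intv z) i - (b i)%:~R <= 0 by rewrite subr_le0.
  by move=> /(ler_wpM2l s0); rewrite mulr0 => ? ?; rewrite mulr1z; lra.
have [eps eps0 epsP] := slack_step (intv u).
have stepP (s : R) : `|s| <= 1 -> (forall i, tight i -> s * (U i)%:~R <= 0) ->
    P (xs + (s * eps) *: intv u).
  move=> s1 sU i; rewrite evD evZ; case: (boolP (tight i)) => ti.
    rewrite (eqP ti) gerDl mulrAC ev_intv; apply: mulr_le0_ge0; last exact: ltW.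
    exact: sU.
  rewrite -lerBrDl; apply: le_trans (epsP i ti).
  apply: le_trans (ler_norm _) _; rewrite -mulrA normrM normrM (gtr0_norm eps0).
  by rewrite ler_piMl // mulr_ge0 // ltW.
have costD x y : cost (x + y) = cost x + cost y by rewrite /cost mulmxDl mx11D.
have costZ a x : cost (a *: x) = a * cost x by rewrite /cost -scalemxAl mx11Z.
have cu : cost (intv u) <= 0.
  have := xs_optimal (stepP 1 _ _); rewrite normr1 lexx mul1r => /(_ isT).
  rewrite costD costZ gerDl pmulr_rle0 //; apply=> i /Utight.
  by rewrite mul1r -(ler_int R).
have zuC : S (z - u).
  split=> //; apply/eqP; rewrite eq_le max1 //= -zC -(ler_int R) -!costE.
  rewrite ler_pM2l // intvB -scaleN1r costD costZ; lra.
(* Maximality of [F] at [z] forces [F u >= 0], while every term of [F u] is at most 0. *)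
have U0 i : tight i -> U i = 0.
  have : F z - F u <= F z.
    apply: le_trans (max2 _ zuC); rewrite /F -sumrB le_eqVlt; apply/orP; left.
    by apply/eqP/eq_bigr => j _; rewrite mulmxBl [RHS]mxE [X in _ = _ + X]mxE.
  rewrite gerBl => Fu ti; apply/eqP; rewrite -oppr_eq0; apply/eqP.
  have : \sum_(j | tight j) - U j == 0.
    rewrite sumrN oppr_eq0 eq_le Fu andbT; apply: sumr_le0 => j; exact: Utight.
  rewrite psumr_eq0 => [/allP/(_ i (mem_index_enum i))/implyP/(_ ti)/eqP //|j tj].
  by rewrite oppr_ge0 Utight.
have : eps *: intv u = 0.
  apply: xs_extreme.
    rewrite -[eps]mul1r; apply: stepP => [|i /U0 ->]; first by rewrite normr1.
    by rewrite mulr0.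
  rewrite -scaleNr -mulN1r; apply: stepP => [|i /U0 ->]; first by rewrite normrN1.
  by rewrite mulr0.
move/eqP; rewrite scaler_eq0 gt_eqF //= => /eqP /rowP u0.
apply/rowP => j; have := u0 j; by rewrite !mxE => /eqP; rewrite intr_eq0 => /eqP.
Qed.

End LatticePoint.

(** * From full column rank to the theorem *)

Lemma pointed_full_rank (R : realFieldType) m n (A : 'M[int]_(m, n.+1)) :
  \rank (map_mx intr A : 'M[rat]_(m, n.+1)) = n.+1 ->
  kerS (rmat R A) [set: 'I_m]%SET = 0.
Proof.
move=> rkA; apply/eqP; rewrite -submx0; apply/rV_subP => x /kerSP xA.
suff -> : x = 0 by apply: sub0mx.
have rowfree : row_free (rmat R A).
  rewrite -row_leq_rank /rmat mxrank_tr -{1}rkA -(mxrank_map (@ratr R)) -map_mx_comp.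
  by rewrite (_ : map_mx _ A = map_mx intr A) //; apply/matrixP => i j; rewrite !mxE /= ratr_int.
apply: (row_free_inj rowfree); rewrite mul0mx.
by apply/rowP => i; rewrite [RHS]mxE; apply: xA; rewrite inE.
Qed.

Lemma det_basis_le_Delta m n (A : 'M[int]_(m, n.+1)) (k : 'I_n.+1) (c : int)
    (f : 'I_n -> 'I_m) : `|c|%N = 1%N ->
  (`|\det (basis A (c *: delta_mx 0 k)%R f)| <= Delta n A)%N.
Proof.
move=> c1; apply: (det_unit_row_le_Delta (k := k) (f := f) c1).
  by move=> j; rewrite !mxE unlift_none.
by move=> i j; rewrite mxE liftK.
Qed.

(** A unit vector extends by [n] rows of [A] to a frame with nonzero determinant, which is a minor
    of [A] up to sign. *)
Lemma Delta_gt0 (R : realFieldType) m n (A : 'M[int]_(m, n.+1)) :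
  kerS (rmat R A) [set: 'I_m]%SET = 0 -> (0 < Delta n A)%N.
Proof.
move=> pointed; pose al : 'rV[int]_n.+1 := 1 *: delta_mx 0 ord0.
have al0 : ralpha al (delta_mx 0 ord0 : 'rV[R]_n.+1) != 0.
  rewrite /ralpha -rowE !mxE eqxx mulr1 rmorph1; exact: oner_neq0.
have qK : ((delta_mx 0 ord0 : 'rV[R]_n.+1) <= kerS (rmat R A) finset.set0)%MS.
  by apply/kerSP => i; rewrite inE.
have [f [_ detf]] := basis_exists pointed (leqnn n) (rank_leq_row _) qK al0.
apply: leq_trans (det_basis_le_Delta A ord0 f (erefl : `|1%:Z|%N = 1%N)).
by rewrite absz_gt0.
Qed.

Local Open Scope classical_set_scope.
Local Open Scope ring_scope.

(* `|x| on 'cV[R]_n is the max norm. *)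
Theorem theorem2 (R : realType) (m n : nat) (hn : (2 <= n)%N)
    (A : 'M[int]_(m, n)) (b : 'cV[int]_m) (c : 'cV[rat]_n)
    (full_column_rank : \rank (map_mx intr A : 'M[rat]_(m, n)) = n)
    (xs : 'cV[R]_n)
    (xs_vertex : vertex (polyhedron R A b) xs)
    (xs_optimal : optimal c (polyhedron R A b) xs)
    (ip_feasible : polyhedron R A b `&` integer_points R n !=set0) :
  exists zs : 'cV[R]_n,
    optimal c (polyhedron R A b `&` integer_points R n) zs /\
    `|xs - zs| < n%:R / 2 * (Delta n.-1 A)%:R.
Proof.
case: n hn A c full_column_rank xs xs_vertex xs_optimal ip_feasible => // n.
rewrite ltnS => n0 A c rkA xs [Pxs vertex_xs] [_ opt_xs] [y0 [Py0 [z0 _ z0E]]] /=.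
have pointed := pointed_full_rank R rkA.
have D0 := Delta_gt0 pointed.
have evE (x : 'cV[R]_n.+1) i : ev (rmat R A) x^T i = (map_mx intr A *m x) i 0.
  by rewrite /ev /rmat -trmx_mul mxE.
have PE (x : 'cV[R]_n.+1) : polyhedron R A b x <->
    forall i, ev (rmat R A) x^T i <= (b i 0)%:~R.
  by split=> H i; [rewrite evE | rewrite -evE]; apply: H.
have PE' (x : 'rV[R]_n.+1) : polyhedron R A b x^T <->
    forall i, ev (rmat R A) x i <= (b i 0)%:~R.
  by rewrite PE trmxK.
have costE (x : 'cV[R]_n.+1) :
    ((map_mx ratr c)^T *m x) 0 0 = (x^T *m map_mx (@ratr R) c) 0 0.
  by rewrite -[x in LHS]trmxK -trmx_mul mxE.
have [d d0 [C CE]] := clear_denominators c.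
have dg : d%:~R *: map_mx (@ratr R) c = map_mx intr C.
  apply/colP => j; rewrite !mxE -(ratr_int R (C j 0)).
  have := congr1 (fun X : 'cV[rat]_n.+1 => X j 0) CE; rewrite !mxE => ->.
  by rewrite rmorphM /= ratr_int.
have ext e : (forall i, ev (rmat R A) (xs^T + e) i <= (b i 0)%:~R) ->
    (forall i, ev (rmat R A) (xs^T - e) i <= (b i 0)%:~R) -> e = 0.
  move=> P1 P2; have [||||E _] := vertex_xs (xs^T + e)^T (xs^T - e)^T (1 / 2).
  - by apply/PE'.
  - by apply/PE'.
  - by apply/andP; split; lra.
  - by apply/colP => j; rewrite !mxE; field.
  by apply: (addrI xs^T); rewrite addr0 -[LHS]trmxK E.
have optr y : (forall i, ev (rmat R A) y i <= (b i 0)%:~R) ->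
    (y *m map_mx (@ratr R) c) 0 0 <= (xs^T *m map_mx (@ratr R) c) 0 0.
  by move=> /PE'/opt_xs; rewrite !costE trmxK.
have feas : exists z : 'rV[int]_n.+1, forall i,
    ev (rmat R A) (map_mx intr z) i <= (b i 0)%:~R.
  by exists z0^T; rewrite -map_trmx; apply/PE; rewrite z0E.
have [z [Pz maxz latfree]] := lattice_point_exists d0 dg ((PE xs).1 Pxs) ext optr feas.
exists (map_mx intr z)^T; split.
  split; first by split; [apply/PE' | exists z^T => //; rewrite map_trmx].
  move=> y [Py [u _ uy]]; rewrite !costE trmxK -uy map_trmx; apply: maxz.
  by rewrite -map_trmx; apply/PE; rewrite uy.
(* The choices [e = 1] and [e = -1] bound coordinate [k] from both sides. *)
have width (k : 'I_n.+1) (e : int) : `|e|%N = 1%N ->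
    e%:~R * ((map_mx intr z : 'rV[R]_n.+1) - xs^T) 0 k < n.+1%:R / 2 * (Delta n A)%:R.
  move=> e1; set w := _ - _.
  have := width_lt (al := e *: delta_mx 0 k) pointed n0 D0
    (fun f => det_basis_le_Delta A k f e1)
    (fun q frq u tau => latfree q u tau frq) (n0 : (2 <= n.+1)%N)
    (rank_leq_row _) (@frac_refl _ _ _ (rmat R A) _ w).
  congr (_ < _); rewrite /ralpha map_mxZ map_delta_mx linearZ /= -scalemxAr mx11Z.
  by rewrite trmx_delta -colE mxE.
(* The max norm is an iterated maximum starting at 0, so a strict bound on it must itself be
   positive. *)
have bd0 : 0 < n.+1%:R / 2 * (Delta n A)%:R :> R.
  by rewrite !mulr_gt0 ?invr_gt0 ?ltr0n.
rewrite [X in X < _]mx_normrE; apply/bigmax_ltP; split=> // -[j i] _ /=.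
rewrite (ord1 i) ltr_norml; have := width j 1 erefl; have := width j (-1) erefl.
by rewrite !mxE mulrN1z mulr1z mul1r mulN1r; lra.
Qed.
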